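(* Let $q$ be a power of a prime $p$, let $n\ge 2$, $s\ge 2$ and $1\le k\le n-1$ be integers, let $\sigma$ be a generator of $\mathrm{Gal}(\mathbb F_{q^n}/\mathbb F_q)$, and let $F(Y),G(Y)\in\mathbb F_q[Y]$ be monic irreducible polynomials of degree $s$. The codes $\mathcal S_k(F)\subseteq R_F$ and $\mathcal S_k(G)\subseteq R_G$ are $\Gamma$-equivalent over $\mathbb F_p$ if and only if there exist $\tau\in\mathrm{Gal}(\mathbb F_q/\mathbb F_p)$ and $\lambda\in\mathbb F_q^\times$ such that $$F^\tau(Y)=\lambda^sG(\lambda^{-1}Y),$$ or, only in the case $n=2$, such that $$F^\tau(Y)=\lambda^s\,\widehat G(\lambda^{-1}Y).$$
   Context: $R=\mathbb F_{q^n}[X;\sigma]$ is the skew polynomial ring with multiplication rule $X\alpha=\sigma(\alpha)X$ for $\alpha\in\mathbb F_{q^n}$; its center is $\mathbb F_q[X^n]$. For a monic irreducible $F\in\mathbb F_q[Y]$ of degree $s\ge2$ the ideal $RF(X^n)$ is two-sided and $R_F:=R/RF(X^n)$. The center of $R_F$ is $\mathbb E_F\cong \mathbb F_q[Y]/(F(Y))\cong\mathbb F_{q^s}$, and $R_F\cong M_n(\mathbb E_F)\cong M_n(\mathbb F_{q^s})$. The code is $$\mathcal S_k(F):=\Big\{\sum_{i=0}^{sk-1}\alpha_iX^i+RF(X^n):\alpha_i\in\mathbb F_{q^n}\Big\}\subseteq R_F .$$ Two subsets $\mathcal D,\mathcal D'$ of $M_n(\mathbb F_{q^s})$ are $\Gamma$-equivalent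 (over $\mathbb F_p$) if $\mathcal D'=U\mathcal D^\rho V$ for some $U,V\in\mathrm{GL}_n(\mathbb F_{q^s})$ and some $\rho\in\mathrm{Aut}_{\mathbb F_p}(\mathbb F_{q^s})$, where $\rho$ acts entrywise on matrices. The codes $\mathcal S_k(F)$ and $\mathcal S_k(G)$ are called $\Gamma$-equivalent if their images under $\mathbb F_q$-algebra isomorphisms $R_F\cong M_n(\mathbb F_{q^s})$ and $R_G\cong M_n(\mathbb F_{q^s})$ are $\Gamma$-equivalent (this does not depend on the chosen isomorphisms). For $P=\sum_i a_iY^i\in\mathbb F_q[Y]$, $P^\tau(Y):=\sum_i\tau(a_i)Y^i$. For a monic $P\in\mathbb F_q[Y]$ of degree $s$ with $P(0)\ne0$, $\widehat P(Y):=P(0)^{-1}Y^sP(Y^{-1})$ is its monic reciprocal polynomial. *)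

(* Defs.v *)
From HB Require Import structures.
From mathcomp Require Import all_boot all_order all_algebra all_fingroup.
From mathcomp Require Import all_solvable all_field.
From mathcomp Require Import generic_quotient ring_quotient.
From mathcomp Require Import boolp classical_sets.

Set Implicit Arguments.
Unset Strict Implicit.
Unset Printing Implicit Defensive.

Import GRing.Theory.
Local Open Scope ring_scope.

Definition skewpoly (A : nzRingType) (s : {rmorphism A -> A}) : Type :=
  {poly A}.

Section SkewPolynomialRing.
Variables (A : nzRingType) (s : {rmorphism A -> A}).
Implicit Types (p q r : {poly A}) (c : A).

Definition skew_mul p q : {poly A} :=
  \sum_(i < size p) \sum_(j < size q) (p`_i * iter i s q`_j) *: 'X^(i + j).

(* Left multiplication by the indeterminate. *)
Definition skewT q : {poly A} := map_poly s q * 'X.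

Lemma skewT_is_zmod : zmod_morphism skewT.
Proof. by move=> p q; rewrite /skewT raddfB mulrBl. Qed.
HB.instance Definition _ :=
  GRing.isZmodMorphism.Build {poly A} {poly A} skewT skewT_is_zmod.

Lemma iter_skewT0 i : iter i skewT 0 = 0.
Proof. by elim: i => //= i ->; rewrite raddf0. Qed.

Lemma iter_skewTD i p q : iter i skewT (p + q) = iter i skewT p + iter i skewT q.
Proof. by elim: i => //= i ->; rewrite raddfD. Qed.

Lemma skewTZ c q : skewT (c *: q) = s c *: skewT q.
Proof. by rewrite /skewT map_polyZ scalerAl. Qed.

Lemma iter_skewT_sum n i (f : 'I_n -> {poly A}) :
  iter i skewT (\sum_j f j) = \sum_j iter i skewT (f j).
Proof.
by elim/big_rec2: _ => [|j p q _ <-]; rewrite ?iter_skewT0 // iter_skewTD.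
Qed.

Lemma iter_skewTZX i c j : iter i skewT (c *: 'X^j) = iter i s c *: 'X^(i + j).
Proof.
elim: i => //= i ->; rewrite skewTZ /skewT rmorphXn /= map_polyX -exprSr.
by rewrite addSn.
Qed.

Definition skew_act n p q := \sum_(i < n) p`_i *: iter i skewT q.

Lemma skew_mulE p q : skew_mul p q = skew_act (size p) p q.
Proof.
apply: eq_bigr => i _; rewrite -[in RHS](coefK q) poly_def iter_skewT_sum.
by rewrite scaler_sumr; apply: eq_bigr => j _; rewrite iter_skewTZX scalerA.
Qed.

Lemma skew_act_wide m n p q : (size p <= m)%N -> (size p <= n)%N ->
  skew_act m p q = skew_act n p q.
Proof.
move=> lm ln; have H k : (size p <= k)%N -> skew_act k p q = skew_act (size p) p q.
  move=> lk; rewrite /skew_act [RHS](big_ord_widen k (fun i => p`_i *: iter i skewT q)) //.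
  rewrite [RHS]big_mkcond; apply: eq_bigr => i _ /=.
  by case: ltnP => // /leq_sizeP -> //; rewrite scale0r.
by rewrite !H.
Qed.

Lemma skew_mulEn n p q : (size p <= n)%N -> skew_mul p q = skew_act n p q.
Proof. by move=> ln; rewrite skew_mulE; apply: skew_act_wide. Qed.

Lemma skew_mulDl p q r : skew_mul (p + q) r = skew_mul p r + skew_mul q r.
Proof.
pose n := maxn (size p) (size q).
rewrite !(@skew_mulEn n) ?size_polyD ?leq_maxl ?leq_maxr //.
by rewrite -big_split; apply: eq_bigr => i _; rewrite coefD scalerDl.
Qed.

Lemma skew_mulDr p q r : skew_mul p (q + r) = skew_mul p q + skew_mul p r.
Proof.
rewrite !skew_mulE -big_split.
by apply: eq_bigr => i _; rewrite iter_skewTD scalerDr.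
Qed.

Lemma skew_mul0l q : skew_mul 0 q = 0.
Proof. by rewrite /skew_mul size_poly0 big_ord0. Qed.

Lemma skew_mulZl c p q : skew_mul (c *: p) q = c *: skew_mul p q.
Proof.
rewrite (@skew_mulEn (size p)) ?size_scale_leq // skew_mulE scaler_sumr.
by apply: eq_bigr => i _; rewrite coefZ scalerA.
Qed.

Lemma skew_mulTl p q : skew_mul (skewT p) q = skewT (skew_mul p q).
Proof.
have lT : (size (skewT p) <= (size p).+1)%N.
  rewrite /skewT; have [->|nz] := eqVneq (map_poly s p) 0.
    by rewrite mul0r size_poly0.
  by rewrite size_mulX // ltnS size_poly.
rewrite (skew_mulEn _ lT) skew_mulE /skew_act big_ord_recl /= {1}/skewT coefMX scale0r add0r.
rewrite raddf_sum; apply: eq_bigr => i _ /=.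
by rewrite skewTZ [(skewT p)`_ _]coefMX /= coef_map.
Qed.

Lemma skew_mul_iterTl i p q : skew_mul (iter i skewT p) q = iter i skewT (skew_mul p q).
Proof. by elim: i => //= i <-; rewrite skew_mulTl. Qed.

Lemma skew_mul_suml n (f : 'I_n -> {poly A}) q :
  skew_mul (\sum_i f i) q = \sum_i skew_mul (f i) q.
Proof. by elim/big_rec2: _ => [|i p r _ <-]; rewrite ?skew_mul0l // skew_mulDl. Qed.

Lemma skew_mulA : associative skew_mul.
Proof.
move=> p q r; rewrite [skew_mul p q]skew_mulE skew_mul_suml skew_mulE.
by apply: eq_bigr => i _; rewrite skew_mulZl skew_mul_iterTl.
Qed.

Lemma skew_mul1l : left_id 1 skew_mul.
Proof.
by move=> q; rewrite skew_mulE size_poly1 /skew_act big_ord1 coef1 scale1r.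
Qed.

Lemma skew_mul1r : right_id 1 skew_mul.
Proof.
move=> p; rewrite -[RHS]coefK poly_def skew_mulE; apply: eq_bigr => i _.
have -> : iter i skewT 1 = 'X^i; last by [].
by elim: (nat_of_ord i) => //= j ->; rewrite /skewT rmorphXn /= map_polyX -exprSr.
Qed.

HB.instance Definition _ := GRing.Zmodule.on (skewpoly s).
HB.instance Definition _ := GRing.Zmodule_isNzRing.Build (skewpoly s)
  skew_mulA skew_mul1l skew_mul1r skew_mulDl skew_mulDr (oner_neq0 {poly A}).

Definition skewC c : skewpoly s := c%:P.
Definition skewX : skewpoly s := 'X.

Lemma skewC_is_zmod : zmod_morphism skewC.
Proof. exact: polyCB. Qed.

Lemma skewC_is_monoid : monoid_morphism skewC.
Proof.
split=> // c d; rewrite /skewC.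
change ((c * d)%:P = skew_mul c%:P d%:P).
rewrite -[c%:P]mulr1 mul_polyC skew_mulZl skew_mul1l.
by rewrite -mul_polyC -polyCM.
Qed.

HB.instance Definition _ :=
  GRing.isZmodMorphism.Build A (skewpoly s) skewC skewC_is_zmod.
HB.instance Definition _ :=
  GRing.isMonoidMorphism.Build A (skewpoly s) skewC skewC_is_monoid.

Lemma skewX_mulE (p : skewpoly s) : skewX * p = map_poly s p * 'X :> {poly A}.
Proof.
change (skew_mul 'X p = skewT p).
have {1}-> : 'X = skewT 1 by rewrite /skewT rmorph1 mul1r.
by rewrite skew_mulTl skew_mul1l.
Qed.

Lemma skewXC c : skewX * skewC c = skewC (s c) * skewX.
Proof.
rewrite skewX_mulE map_polyC.
change ((s c)%:P * 'X = skew_mul (s c)%:P 'X).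
by rewrite -[(s c)%:P]mulr1 mul_polyC skew_mulZl skew_mul1l -scalerAl mul1r.
Qed.

Lemma skewpolyE (p : skewpoly s) :
  p = \sum_(i < size (p : {poly A})) skewC p`_i * skewX ^+ i.
Proof.
have skewCM c (q : skewpoly s) : skewC c * q = c *: (q : {poly A}).
  change (skew_mul c%:P q = c *: (q : {poly A})).
  by rewrite -[c%:P]mulr1 mul_polyC skew_mulZl skew_mul1l.
have skewXn i : skewX ^+ i = 'X^i :> {poly A}.
  by elim: i => // i IH; rewrite exprS skewX_mulE IH rmorphXn /= map_polyX -exprSr.
rewrite -[LHS]coefK poly_def; apply: eq_bigr => i _.
by rewrite skewCM skewXn.
Qed.

End SkewPolynomialRing.

HB.mixin Record isTwoSidedIdeal (A : nzRingType) (I : A -> bool) := {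
  two_sidedMl : forall a u, u \in (I : {pred A}) -> a * u \in (I : {pred A});
  two_sidedMr : forall a u, u \in (I : {pred A}) -> u * a \in (I : {pred A})
}.

(* The ideal need not be proper. *)
#[short(type="twoSidedIdeal")]
HB.structure Definition TwoSidedIdeal (A : nzRingType) :=
  {I of GRing.ZmodClosed A I & isTwoSidedIdeal A I}.

(* ring_quotient only gives a ring structure to quotients of commutative
   rings, so the additive quotient is equipped with one here. *)
Section TwoSidedQuotient.
Local Open Scope quotient_scope.
Variables (A : nzRingType) (I : twoSidedIdeal A).

Definition tsquot : Type := Quotient.quot (I : zmodClosed A).

HB.instance Definition _ := GRing.Zmodule.on tsquot.

Definition tsclass (a : A) : tsquot := \pi_(Quotient.quot (I : zmodClosed A)) a.

Definition tsrep (x : tsquot) : A := repr (x : Quotient.quot (I : zmodClosed A)).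

Lemma tsrepK x : tsclass (tsrep x) = x.
Proof. exact: reprK. Qed.

Lemma tsclassP a b : reflect (tsclass a = tsclass b) (a - b \in I).
Proof.
have -> : (a - b \in I) = (tsclass a == tsclass b :> Quotient.quot I).
  exact: Quotient.idealrBE.
exact: eqP.
Qed.

Lemma tsclass_is_zmod : zmod_morphism tsclass.
Proof. by move=> a b; rewrite /tsclass raddfB. Qed.

HB.instance Definition _ :=
  GRing.isZmodMorphism.Build A tsquot tsclass tsclass_is_zmod.

Definition tsquot_one : tsquot := tsclass 1.
Definition tsquot_mul (x y : tsquot) : tsquot := tsclass (tsrep x * tsrep y).

Lemma tsquot_mulE a b : tsquot_mul (tsclass a) (tsclass b) = tsclass (a * b).
Proof.
apply/tsclassP; set a' := tsrep _; set b' := tsrep _.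
have ha : a' - a \in I by apply/tsclassP; rewrite tsrepK.
have hb : b' - b \in I by apply/tsclassP; rewrite tsrepK.
have -> : a' * b' - a * b = a' * (b' - b) + (a' - a) * b.
  by rewrite mulrBr mulrBl addrA subrK.
by apply: rpredD; [exact: two_sidedMl | exact: two_sidedMr].
Qed.

Lemma tsquot_mulA : associative tsquot_mul.
Proof.
by move=> x y z; rewrite -[x]tsrepK -[y]tsrepK -[z]tsrepK !tsquot_mulE mulrA.
Qed.

Lemma tsquot_mul1 : left_id tsquot_one tsquot_mul.
Proof. by move=> x; rewrite -[x]tsrepK tsquot_mulE mul1r. Qed.

Lemma tsquot_mulr1 : right_id tsquot_one tsquot_mul.
Proof. by move=> x; rewrite -[x]tsrepK tsquot_mulE mulr1. Qed.

Lemma tsquot_mulDl : left_distributive tsquot_mul +%R.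
Proof.
move=> x y z; rewrite -[x]tsrepK -[y]tsrepK -[z]tsrepK.
by rewrite -raddfD !tsquot_mulE mulrDl raddfD.
Qed.

Lemma tsquot_mulDr : right_distributive tsquot_mul +%R.
Proof.
move=> x y z; rewrite -[x]tsrepK -[y]tsrepK -[z]tsrepK.
by rewrite -raddfD !tsquot_mulE mulrDr raddfD.
Qed.

HB.instance Definition _ := GRing.Zmodule_isPzRing.Build tsquot
  tsquot_mulA tsquot_mul1 tsquot_mulr1 tsquot_mulDl tsquot_mulDr.

Lemma tsclass_is_monoid : monoid_morphism tsclass.
Proof. by split=> // a b; rewrite -tsquot_mulE. Qed.

HB.instance Definition _ :=
  GRing.isMonoidMorphism.Build A tsquot tsclass tsclass_is_monoid.

End TwoSidedQuotient.

Section SkewQuotient.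
Variables (Fq : finFieldType) (L : splittingFieldType Fq).
Variable sigma : gal_of {:L}.

(* Fq is identified with the scalars a%:A of L. *)
Definition eval_skewXn (n : nat) (F : {poly Fq}) : skewpoly sigma :=
  \sum_(i < size F) skewC sigma (F`_i)%:A * (skewX sigma ^+ n) ^+ i.

Lemma skewXnC i c : skewX sigma ^+ i * skewC sigma c =
  skewC sigma (iter i sigma c) * skewX sigma ^+ i.
Proof.
elim: i => [|i IH]; first by rewrite expr0 mul1r mulr1.
by rewrite exprS -mulrA IH mulrA skewXC -mulrA.
Qed.

Lemma iter_gal_dim c : iter (\dim {:L}) sigma c = c.
Proof.
have it i : iter i sigma c = (sigma ^+ i)%g c.
  elim: i => [|i IH]; first by rewrite expg0 gal_id.
  by rewrite expgSr galM ?memvf //= IH.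
have gL : galois 1 {:L} := finField_galois (sub1v _).
have := galois_dim gL; rewrite dimv1 divn1 it => ->.
have sG : sigma \in 'Gal({:L} / 1)%g.
  by rewrite gal_kHom ?sub1v ?k1HomE ?ahomWin.
by rewrite expg_cardG // gal_id.
Qed.

Lemma eval_skewXn_central F (p : skewpoly sigma) :
  GRing.comm p (eval_skewXn (\dim {:L}) F).
Proof.
have cC c : GRing.comm (skewX sigma ^+ \dim {:L}) (skewC sigma c).
  by rewrite /GRing.comm skewXnC iter_gal_dim.
have cA a : GRing.comm (skewX sigma) (skewC sigma a%:A).
  rewrite /GRing.comm skewXC; congr (skewC _ _ * _).
  by change (sigma a%:A = a%:A); rewrite linearZ /= rmorph1.
have cCC c d : GRing.comm (skewC sigma c) (skewC sigma d).
  by rewrite /GRing.comm -!rmorphM mulrC.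
apply: commr_sum => i _; apply: commrM.
  rewrite (skewpolyE p); apply/commr_sym/commr_sum => j _.
  by apply: commrM => //; apply/commrX/commr_sym.
apply: commrX; rewrite (skewpolyE p); apply/commr_sym/commr_sum => j _.
by apply: commrM => //; apply/commrX/commr_sym/commrX.
Qed.

(* The left ideal R F(X^n), n being the degree of L over Fq. *)
Definition RF_ideal (F : {poly Fq}) : {pred skewpoly sigma} :=
  fun p => `[< exists r, p = r * eval_skewXn (\dim {:L}) F >].

Lemma RF_idealB F : zmod_closed (RF_ideal F).
Proof.
split; first by apply/asboolP; exists 0; rewrite mul0r.
move=> _ _ /asboolP[r ->] /asboolP[t ->].
by apply/asboolP; exists (r - t); rewrite mulrBl.
Qed.

Lemma RF_idealMl F a u : u \in RF_ideal F -> a * u \in RF_ideal F.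
Proof.
by move=> /asboolP[r ->]; apply/asboolP; exists (a * r); rewrite mulrA.
Qed.

Lemma RF_idealMr F a u : u \in RF_ideal F -> u * a \in RF_ideal F.
Proof.
move=> /asboolP[r ->]; apply/asboolP; exists (r * a).
by rewrite -!mulrA eval_skewXn_central.
Qed.

HB.instance Definition _ F :=
  GRing.isZmodClosed.Build (skewpoly sigma) (RF_ideal F) (RF_idealB F).
HB.instance Definition _ F :=
  isTwoSidedIdeal.Build (skewpoly sigma) (RF_ideal F)
    (@RF_idealMl F) (@RF_idealMr F).

Definition RF (F : {poly Fq}) : pzRingType := tsquot (RF_ideal F).

Definition RFclass (F : {poly Fq}) : skewpoly sigma -> RF F :=
  @tsclass (skewpoly sigma) (RF_ideal F).

Local Open Scope classical_set_scope.

Definition skew_code (s k : nat) (F : {poly Fq}) : set (RF F) :=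
  [set x | exists alpha : 'I_(s * k) -> L,
     x = RFclass F (\sum_i skewC sigma (alpha i) * skewX sigma ^+ i)].

(* The Fq-algebra structures of RF F and 'M[E]_n are given by the images of the
   scalars, so an Fq-algebra morphism is a ring morphism matching these. *)
Definition Fq_alg_iso (E : fieldExtType Fq) (n : nat) (F : {poly Fq})
    (phi : {rmorphism RF F -> 'M[E]_n}) : Prop :=
  bijective phi /\
  forall a : Fq, phi (RFclass F (skewC sigma a%:A)) = (a%:A)%:M.

End SkewQuotient.

Arguments RFclass {Fq L} sigma F.
Arguments skew_code {Fq L} sigma s k F.

(* The prime subfield consists of the m%:R; the second clause makes f an
   automorphism over it. *)
Definition prime_field_aut (K : fieldType) (f : {rmorphism K -> K}) : Prop :=
  bijective f /\ forall m : nat, f m%:R = m%:R.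

Local Open Scope classical_set_scope.

Definition Gamma_equiv (E : fieldType) (n : nat) (D D' : set 'M[E]_n) : Prop :=
  exists (U V : 'M[E]_n) (rho : {rmorphism E -> E}),
    [/\ U \in unitmx, V \in unitmx, prime_field_aut rho
      & D' = [set U *m map_mx rho M *m V | M in D]].

(* By Skolem-Noether another choice of phi and psi changes the images only up
   to Gamma_equiv, which is why one choice is enough. *)
Definition codes_Gamma_equiv (Fq : finFieldType) (L : splittingFieldType Fq)
    (sigma : gal_of {:L}) (E : fieldExtType Fq) (n s k : nat)
    (F G : {poly Fq}) : Prop :=
  exists (phi : {rmorphism RF sigma F -> 'M[E]_n})
         (psi : {rmorphism RF sigma G -> 'M[E]_n}),
    [/\ Fq_alg_iso phi, Fq_alg_iso psi
      & Gamma_equiv (phi @` skew_code sigma s k F)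
                    (psi @` skew_code sigma s k G)].

(* Y^s P(Y^-1) reverses the s + 1 coefficients of a P of degree s. *)
Definition monic_reciprocal (K : fieldType) (s : nat) (P : {poly K}) :
    {poly K} :=
  P.[0]^-1 *: \poly_(i < s.+1) P`_(s - i).

(* Main.v *)
(* Fix the matrix ring M = M_n(E). An isomorphism R_F -> M is the same thing as a
   ring morphism iota : L -> M together with x in M such that
   x iota(c) = iota(sigma c) x, F(x^n) = 0 and the elements iota(c) x^i, i < sn,
   form a basis; the code becomes the left L-span of the x^i, i < sk.

   Since 0 < sk < sn, the left and right idealizers of the code are iota(L), so an
   equivalence C_1 w = C_2 of two such codes forces iota_1(L) = iota_2(L), hence
   iota_1 = iota_2 o (Frobenius power), and x_1 is twisted by sigma like x_2.
   Multiplication by x_1 keeps a hyperplane of C_2 inside C_2, and reading off top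
   degrees in x_2 leaves only x_1 = iota_2(b) x_2, or n = 2 and
   x_1 x_2 = iota_2(b). Substituting in F(x_1^n) = 0 and comparing with
   G(x_2^n) = 0 gives the two relations, with lambda the norm of b.

   Conversely, x_1 = iota(b) x_2 or x_1 = iota(b) x_2^-1 with b of the prescribed
   norm defines an equivalence, once R_F is known to be split by E. That amounts
   to solving N(y) = e in the units of L (x) E for a root e of F in E; both this and
   the surjectivity of the norm of L follow by counting from Hilbert 90 for
   L (x) E, where L (x) E is realised as the centralizer of L in M. *)

Require Import Defs.
From HB Require Import structures.
From mathcomp Require Import all_boot all_order all_algebra all_fingroup.
From mathcomp Require Import all_solvable all_field.
From mathcomp Require Import zify.
From mathcomp Require Import boolp classical_sets.

Set Implicit Arguments.
Unset Strict Implicit.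
Unset Printing Implicit Defensive.

Import GRing.Theory.
Local Open Scope ring_scope.

(** * Frobenius endomorphisms of finite fields *)

Definition frob (K : fieldType) (p : nat) (pcharKp : p \in [pchar K]) (e : nat)
  (x : K) : K := x ^+ (p ^ e).

Section Frobenius.
Variables (K : fieldType) (p : nat) (pcharKp : p \in [pchar K]) (e : nat).

Lemma frob_is_zmod_morphism : zmod_morphism (frob pcharKp e).
Proof.
have frobD x y : frob pcharKp e (x + y) = frob pcharKp e x + frob pcharKp e y.
  apply: exprDn_pchar; rewrite (eq_pnat _ (pcharf_eq pcharKp)) pnatX pnat_id //.
  exact: pcharf_prime pcharKp.
by move=> x y; apply/eqP; rewrite eq_sym subr_eq -frobD subrK.
Qed.

Lemma frob_is_monoid_morphism : monoid_morphism (frob pcharKp e).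
Proof. by split=> [|x y]; rewrite /frob ?expr1n ?exprMn. Qed.

HB.instance Definition _ :=
  GRing.isZmodMorphism.Build K K (frob pcharKp e) frob_is_zmod_morphism.
HB.instance Definition _ :=
  GRing.isMonoidMorphism.Build K K (frob pcharKp e) frob_is_monoid_morphism.

End Frobenius.

Section FinFieldEndo.
Variables (K : finFieldType) (p : nat) (pcharKp : p \in [pchar K]).

Lemma card_finField_pchar : exists2 m, (0 < m)%N & #|K| = (p ^ m)%N.
Proof.
have /p_natP[m cardK] : p.-nat #|K|.
  by rewrite -cardsT; apply: (pprimeChar_pgroup pcharKp).
exists m => //; rewrite lt0n; apply: contraTneq (finNzRing_gt1 K) => m0.
by rewrite cardK m0.
Qed.

(** The residues of 0, ..., p-1 are already p distinct roots of X^p - X; a fixed element outside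
    this list would be one root too many. *)
Lemma finField_fixed_frob (x : K) : x ^+ p = x -> exists m : nat, x = m%:R.
Proof.
move=> xp; have p_pr := pcharf_prime pcharKp; have p_gt1 := prime_gt1 p_pr.
pose r := [seq (i : nat)%:R : K | i <- iota 0 p].
have [/mapP[i _ ->]|xNr] := boolP (x \in r); first by exists i.
have szP : size ('X^p - 'X : {poly K}) = p.+1.
  by rewrite size_polyDl size_polyXn // size_polyN size_polyX.
have := @max_poly_roots _ ('X^p - 'X : {poly K}) (x :: r).
rewrite -size_poly_gt0 szP => /(_ isT) /=.
rewrite size_map size_iota rootE !hornerE xp subrr eqxx xNr /=.
have -> : all (root ('X^p - 'X)) r.
  apply/allP => _ /mapP[i _ ->]; rewrite rootE !hornerE -natrX.
  by have := pFrobenius_aut_nat pcharKp i; rewrite pFrobenius_autE natrX => ->; rewrite subrr.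
rewrite map_inj_in_uniq ?iota_uniq ?ltnn => [/(_ isT isT)|i j] //.
rewrite !mem_iota /= !add0n.
wlog le_ij : i j / (i <= j)%N.
  by move=> W i_p j_p e; case/orP: (leq_total i j) => l; [|apply/esym]; apply: W.
move=> i_p j_p /eqP; rewrite eq_sym -subr_eq0 -natrB // -(dvdn_pcharf pcharKp).
have [->//|lt_ij] := eqVneq i j.
move/dvdn_leq; rewrite subn_gt0 ltn_neqAle lt_ij le_ij => /(_ isT).
by rewrite leqNgt (leq_ltn_trans (leq_subr _ _) j_p).
Qed.

(* The orbit polynomial of a generator [a] of the unit group under Frobenius has
   coefficients in the prime field, so [f a] is again one of its roots. *)
Lemma finField_endo_frob (f : {rmorphism K -> K}) :
  exists e, forall x, f x = x ^+ (p ^ e).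
Proof.
have p_pr := pcharf_prime pcharKp.
have [a gen_a] : exists a : K, forall x, x != 0 -> exists l, x = a ^+ l.
  have /cyclicP[u Du] : cyclic [set: {unit K}] by apply: field_unit_group_cyclic.
  exists (val u) => x nz_x; have := finset.in_setT (finField_unit nz_x).
  by rewrite Du => /cycleP[l /(congr1 val)]; rewrite FinRing.val_unitX; exists l.
have [m m_gt0 cardK] := card_finField_pchar.
pose h := \prod_(i < m) ('X - (a ^+ (p ^ i))%:P).
have h_frob : map_poly (frob pcharKp 1) h = h.
  rewrite rmorph_prod /h -(prednK m_gt0) big_ord_recr big_ord_recl /= mulrC; congr (_ * _).
    rewrite rmorphB /= map_polyX map_polyC /= /frob -exprM -expnD addn1 prednK // -cardK.
    by rewrite expf_card expr1.
  apply: eq_bigr => i _; rewrite rmorphB /= map_polyX map_polyC /= /frob.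
  by rewrite -exprM -expnD addn1.
have h_f : map_poly f h = h.
  apply/polyP => i; rewrite coef_map /=.
  have /finField_fixed_frob[l ->] : h`_i ^+ p = h`_i.
    by rewrite -[in RHS]h_frob coef_map /= /frob expn1.
  by rewrite rmorph_nat.
have /eqP : h.[f a] = 0.
  rewrite -h_f horner_map /= /h horner_prod (bigD1 (Ordinal m_gt0)) //=.
  by rewrite !hornerE expn0 expr1 subrr mul0r rmorph0.
rewrite horner_prod prodf_seq_eq0 => /hasP[i _]; rewrite !hornerE subr_eq0 => /eqP fa.
exists i => x; have [->|/gen_a[l ->]] := eqVneq x 0.
  by rewrite rmorph0 expr0n expn_eq0 -leqn0 leqNgt prime_gt0.
by rewrite rmorphXn /= fa -!exprM mulnC.
Qed.

End FinFieldEndo.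

(** * Cyclic Galois extensions *)

Section CyclicGalois.
Variables (Fq : finFieldType) (L : splittingFieldType Fq) (sigma : gal_of {:L}).
Hypothesis sigma_gen : generator 'Gal({:L} / 1)%g sigma.
Let n := \dim {:L}.

Lemma iter_galE i c : iter i sigma c = (sigma ^+ i)%g c.
Proof.
elim: i => [|i IHi]; first by rewrite expg0 gal_id.
by rewrite expgSr galM ?memvf //= IHi.
Qed.

Lemma galois_over1 : galois 1 {:L}.
Proof. exact: finField_galois (sub1v _). Qed.

Lemma order_gal_generator : #[sigma]%g = n.
Proof.
have := galois_dim galois_over1; rewrite dimv1 divn1 -/n => ->.
by rewrite orderE -(eqP sigma_gen).
Qed.

Lemma iter_gal_inj i j :
  (forall c, iter i sigma c = iter j sigma c) -> i = j %[mod n].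
Proof.
move=> eq_ij; apply/eqP; rewrite -order_gal_generator -eq_expg_mod_order.
by apply/gal_eqP => c _; rewrite -!iter_galE.
Qed.

Lemma iter_gal_mod i c : iter (i %% n) sigma c = iter i sigma c.
Proof. by rewrite !iter_galE -order_gal_generator expg_mod_order. Qed.

Lemma gal_fixed_scalar c : sigma c = c -> exists a, c = a%:A.
Proof.
move=> sc; apply/vlineP; rewrite -(galois_fixedField galois_over1).
apply/fixedFieldP; first exact: memvf.
rewrite (eqP sigma_gen) => _ /cycleP[i ->].
by rewrite -iter_galE; elim: i => //= i ->.
Qed.

Lemma gal_scalar a : sigma a%:A = a%:A.
Proof. by rewrite linearZ /= rmorph1. Qed.

(** Dedekind's independence of characters, with coefficients in any ring that receives L. By
    induction on the set of exponents: choose a with sigma^i a <> sigma^j a and subtract m(sigma^j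
    a) times the relation at c from the relation at ac. Term j disappears, and b_i is multiplied by
    the image of a nonzero element of L. *)
Lemma dedekind (M : pzRingType) (m : {rmorphism L -> M}) (b : nat -> M) :
    (forall c, \sum_(i < n) m (iter i sigma c) * b i = 0) ->
  forall i, (i < n)%N -> b i = 0.
Proof.
move=> sum0; pose r := iota 0 n.
suffices: forall (r : seq nat) (b : nat -> M), uniq r -> {subset r <= iota 0 n} ->
    (forall c, \sum_(i <- r) m (iter i sigma c) * b i = 0) -> {in r, forall i, b i = 0}.
  move=> /(_ r b (iota_uniq _ _) (fun _ => id)) br i lt_in.
  apply: br; last by rewrite mem_iota.
  move=> c; rewrite -[RHS](sum0 c).
  by rewrite -(big_mkord xpredT (fun i => m (iter i sigma c) * b i)) /index_iota subn0.
elim=> {b sum0}// j {}r IHr b /= /andP[jNr r_uniq] sub_r sum0.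
have br i : i \in r -> b i = 0.
  move=> r_i; have [a nz_a] : exists a, iter i sigma a - iter j sigma a != 0.
    apply: contrapT => /forallNP eq_ij; have : i = j %[mod n].
      by apply: iter_gal_inj => c; apply/eqP; rewrite -subr_eq0; apply: contrapT => /negP /eq_ij.
    have lt_n l : l \in j :: r -> (l < n)%N by move/sub_r; rewrite mem_iota.
    rewrite !modn_small ?lt_n ?mem_head ?inE ?r_i ?orbT // => eij.
    by rewrite -eij r_i in jNr.
  suffices: m (iter i sigma a - iter j sigma a) * b i = 0.
    move/(congr1 ( *%R (m (iter i sigma a - iter j sigma a)^-1))).
    by rewrite mulrA -rmorphM mulVf // rmorph1 mul1r mulr0.
  pose b' l := m (iter l sigma a - iter j sigma a) * b l.
  suffices sum0' c : \sum_(i <- r) m (iter i sigma c) * b' i = 0.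
    by apply: (IHr b' r_uniq _ sum0') r_i => l r_l; rewrite sub_r // inE r_l orbT.
  have := sum0 (a * c); have := congr1 ( *%R (m (iter j sigma a))) (sum0 c).
  have itM l x y : iter l sigma (x * y) = iter l sigma x * iter l sigma y.
    by rewrite !iter_galE rmorphM.
  rewrite !big_cons mulrDr mulr0 mulrA -rmorphM -itM => e1 e2.
  have := congr2 (fun x y => x - y) e2 e1; rewrite subr0 addrAC opprD addrA subrr add0r addrC.
  rewrite mulr_sumr -sumrB => e3; rewrite -[RHS]e3. apply: eq_bigr => l _.
  by rewrite /b' itM !mulrA -!rmorphM -mulrBl -rmorphB /= -mulrBl mulrC.
move=> i; rewrite inE => /orP[/eqP->|/br//].
have := sum0 1; rewrite big_cons big_seq big1 ?addr0 => [|l /br->]; last by rewrite mulr0.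
by rewrite iter_galE !rmorph1 mul1r.
Qed.

(** Multiplying the sum on the right by m(c) moves m(sigma^i c) to the left of each term, which is a
    Dedekind relation. *)
Lemma graded_independence (M : pzRingType) (m : {rmorphism L -> M}) (t : nat -> M) :
    (forall i c, (i < n)%N -> t i * m c = m (iter i sigma c) * t i) ->
    \sum_(i < n) t i = 0 ->
  forall i, (i < n)%N -> t i = 0.
Proof.
move=> tm sum0; apply: (@dedekind _ m) => c.
have := congr1 ( *%R^~ (m c)) sum0; rewrite mul0r mulr_suml => e; rewrite -[RHS]e.
by apply: eq_bigr => i _; rewrite tm.
Qed.

End CyclicGalois.

Section ExactCounting.
Local Open Scope group_scope.

(** Kernel and image orders multiply to #|D| for both maps. Hence |ker f| |im f| = |ker N| |im N| <=
    |im f| |im N|, so im N is not smaller than ker f. *)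
Lemma morphim_eq_ker (gT : finGroupType) (D : {group gT})
    (f N : {morphism D >-> gT}) :
    'ker N \subset f @* D -> N @* D \subset 'ker f -> N @* D = 'ker f.
Proof.
move=> kerN imN; apply/eqP; rewrite eqEcard imN /=.
have cardD (h : {morphism D >-> gT}) : (#|'ker h| * #|h @* D|)%N = #|D|.
  rewrite card_morphim (finset.setIidPr (fintype.subxx _)) Lagrange //.
  exact: finset.subsetIl.
have := cardD f; rewrite -(cardD N) mulnC => e.
have := leq_mul (subset_leq_card kerN) (leqnn #|N @* D|).
by rewrite -e leq_pmul2l // cardG_gt0.
Qed.

End ExactCounting.

(** * Hilbert 90 and the norm of L (x) E *)

Lemma sum_cyclic_shift (V : zmodType) n (t : nat -> V) : t n = t 0 ->
  \sum_(i < n) t i.+1 = \sum_(i < n) t i.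
Proof.
case: n => [|n] tn0; first by rewrite !big_ord0.
by rewrite big_ord_recr big_ord_recl addrC /= tn0.
Qed.

Section Graded.
Variables (Fq : finFieldType) (L : splittingFieldType Fq) (sigma : gal_of {:L}).
Variables (M : pzRingType) (m : {rmorphism L -> M}).

(** Degree 0 is the centralizer of the image of L. For a generator sigma the degree matters only
    modulo n. *)
Definition graded i (A : M) := forall c, A * m c = m (iter i sigma c) * A.

Lemma graded1 : graded 0 1.
Proof. by move=> c; rewrite mulr1 mul1r. Qed.

Lemma graded_scalar c : graded 0 (m c).
Proof. by move=> d; rewrite -!rmorphM mulrC. Qed.

Lemma gradedM i j A B : graded i A -> graded j B -> graded (i + j) (A * B).
Proof. by move=> gA gB c; rewrite -mulrA gB mulrA gA -mulrA iterD. Qed.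

Lemma gradedX i k A : graded i A -> graded (k * i) (A ^+ k).
Proof.
move=> gA; elim: k => [|k IHk]; first exact: graded1.
by rewrite exprS mulSn; apply: gradedM.
Qed.

Lemma graded_sum i (I : Type) (r : seq I) (P : pred I) (A : I -> M) :
  (forall k, P k -> graded i (A k)) -> graded i (\sum_(k <- r | P k) A k).
Proof.
move=> gA c; rewrite mulr_suml mulr_sumr.
by apply: eq_bigr => k /gA ->.
Qed.

Lemma eq_graded i j A : i = j %[mod \dim {:L}] -> 
  generator 'Gal({:L} / 1)%g sigma -> graded i A -> graded j A.
Proof.
by move=> eq_ij gen gA c; rewrite gA -(iter_gal_mod gen) eq_ij iter_gal_mod.
Qed.

End Graded.

(** * Matrix model of L (x) E and Hilbert 90 *)

Section Splitting.
Variables (Fq : finFieldType) (L : splittingFieldType Fq) (sigma : gal_of {:L}).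
Hypothesis sigma_gen : generator 'Gal({:L} / 1)%g sigma.
Variables (n' : nat).
Let n := n'.+1.
Hypothesis dim_L : \dim {:L} = n.

Definition cyc_basis : n.-tuple L := tcast dim_L (vbasis {:L}).

Lemma cyc_basisP : basis_of {:L} cyc_basis.
Proof. by rewrite basisEdim val_tcast -basisEdim vbasisP. Qed.

Variables (E : fieldType) (j : {rmorphism Fq -> E}).

Definition cyc_coord (c : L) : 'rV[Fq]_n := \row_i coord cyc_basis i c.
Definition cyc_lin_mx (f : 'End(L)) : 'M[Fq]_n :=
  \matrix_i cyc_coord (f cyc_basis`_i).

Lemma cyc_coord_is_linear : linear cyc_coord.
Proof. by move=> a u v; apply/rowP => i; rewrite !mxE linearP. Qed.
HB.instance Definition _ :=
  GRing.isLinear.Build Fq L 'rV[Fq]_n _ cyc_coord cyc_coord_is_linear.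

Lemma cyc_coordK c : c = \sum_i cyc_coord c 0 i *: cyc_basis`_i.
Proof.
rewrite {1}(coord_basis cyc_basisP (memvf c)).
by apply: eq_bigr => i _; rewrite mxE.
Qed.

Lemma cyc_coord_surj (u : 'rV[Fq]_n) : exists c, u = cyc_coord c.
Proof.
exists (\sum_i u 0 i *: cyc_basis`_i); apply/rowP => i; rewrite mxE.
by rewrite coord_sum_free // (basis_free cyc_basisP).
Qed.

Lemma cyc_coord_lin c f : cyc_coord c *m cyc_lin_mx f = cyc_coord (f c).
Proof.
rewrite {2}[c]cyc_coordK !linear_sum mulmx_sum_row.
by apply: eq_bigr => i _; rewrite rowK !linearZ.
Qed.

(* Matrices act on row vectors, on the right, so it is the matrix of sigma^-1 that
   satisfies cyc_shift * cyc_mul c = cyc_mul (sigma c) * cyc_shift. *)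
Definition cyc_row (c : L) : 'rV[E]_n := map_mx j (cyc_coord c).
Definition cyc_mul (c : L) : 'M[E]_n := map_mx j (cyc_lin_mx (amulr c)).
Definition cyc_shift : 'M[E]_n := map_mx j (cyc_lin_mx (sigma^-1)%g).

Lemma cyc_rowM c d : cyc_row c *m cyc_mul d = cyc_row (c * d).
Proof. by rewrite -map_mxM cyc_coord_lin lfunE. Qed.

Lemma cyc_row_shift c : cyc_row c *m cyc_shift = cyc_row ((sigma^-1)%g c).
Proof. by rewrite -map_mxM cyc_coord_lin. Qed.

Lemma cyc_row_basis (i : 'I_n) : cyc_row cyc_basis`_i = delta_mx 0 i.
Proof.
apply/rowP => k; rewrite !mxE (coord_free _ _ (basis_free cyc_basisP)) eqxx.
by rewrite eq_sym rmorph_nat.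
Qed.

Lemma cyc_row_inj (A B : 'M[E]_n) :
  (forall c, cyc_row c *m A = cyc_row c *m B) -> A = B.
Proof.
by move=> AB; apply/row_matrixP => i; rewrite !rowE -cyc_row_basis AB.
Qed.

Lemma cyc_row0 c : cyc_row c = 0 -> c = 0.
Proof.
move/eqP; rewrite /cyc_row map_mx_eq0 => /eqP c0.
by rewrite [c]cyc_coordK c0 big1 // => i _; rewrite mxE scale0r.
Qed.

Lemma cyc_rowB c d : cyc_row (c - d) = cyc_row c - cyc_row d.
Proof. by rewrite /cyc_row linearB map_mxB. Qed.

Lemma cyc_mul_is_zmod_morphism : zmod_morphism cyc_mul.
Proof.
move=> c d; apply: cyc_row_inj => x.
by rewrite mulmxBr !cyc_rowM mulrBr cyc_rowB.
Qed.

Lemma cyc_mul_is_monoid_morphism : monoid_morphism cyc_mul.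
Proof.
split=> [|c d]; apply: cyc_row_inj => x.
  by rewrite cyc_rowM mulr1 mulmx1.
by rewrite -[_ * _ :> 'M_n]/(_ *m _) mulmxA !cyc_rowM mulrA.
Qed.

HB.instance Definition _ :=
  GRing.isZmodMorphism.Build L 'M[E]_n cyc_mul cyc_mul_is_zmod_morphism.
HB.instance Definition _ :=
  GRing.isMonoidMorphism.Build L 'M[E]_n cyc_mul cyc_mul_is_monoid_morphism.

Lemma cyc_mul_scalar a : cyc_mul a%:A = (j a)%:M.
Proof.
apply: cyc_row_inj => c; rewrite cyc_rowM mul_mx_scalar /cyc_row.
by rewrite -scalerAr mulr1 linearZ /= map_mxZ.
Qed.

Local Notation graded := (@graded _ L sigma _ (cyc_mul : {rmorphism _ -> _})).

Lemma cyc_shift_graded : graded 1 cyc_shift.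
Proof.
move=> c; apply: cyc_row_inj => x; rewrite -![_ * _ :> 'M_n]/(_ *m _) !mulmxA.
by rewrite !cyc_rowM !cyc_row_shift cyc_rowM rmorphM /= -galM ?memvf // mulgV gal_id.
Qed.

Lemma cyc_row_shiftX i c : cyc_row c *m cyc_shift ^+ i = cyc_row ((sigma ^- i)%g c).
Proof.
elim: i c => [|i IHi] c; first by rewrite expr0 mulmx1 expg0 invg1 gal_id.
rewrite exprS -[_ * _]/(_ *m _) mulmxA cyc_row_shift IHi -galM ?memvf //.
by rewrite -invMg -expgSr.
Qed.

Lemma cyc_shiftXn : cyc_shift ^+ n = 1.
Proof.
apply: cyc_row_inj => c; rewrite cyc_row_shiftX mulmx1.
have := expg_order sigma; rewrite (order_gal_generator sigma_gen) dim_L => ->.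
by rewrite invg1 gal_id.
Qed.

(** The row of 1 is a cyclic vector: every other row is its image under some [cyc_mul c], and this
    commutes with elements of degree 0. *)
Lemma graded0_row1_inj (A B : 'M[E]_n) : graded 0 A -> graded 0 B ->
  cyc_row 1 *m A = cyc_row 1 *m B -> A = B.
Proof.
move=> gA gB AB; apply: cyc_row_inj => c.
rewrite -[c]mul1r -cyc_rowM -!mulmxA.
by rewrite -![cyc_mul _ *m _](gA, gB) -?gA -?gB ![_ * cyc_mul _]/(_ *m _) !mulmxA AB.
Qed.

(** Inverse of A |-> [cyc_row 1 *m A] on elements of degree 0; it identifies the centralizer of L
    with L (x) E, a space of dimension n over E. *)
Definition cyc_of_row (u : 'rV[E]_n) : 'M[E]_n :=
  \sum_i u 0 i *: cyc_mul cyc_basis`_i.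

Lemma cyc_of_row_graded u : graded 0 (cyc_of_row u).
Proof.
apply: graded_sum => i _ c; rewrite -scalerAl -scalerAr.
by rewrite (graded_scalar sigma (cyc_mul : {rmorphism _ -> _})).
Qed.

Lemma cyc_of_rowK u : cyc_row 1 *m cyc_of_row u = u.
Proof.
rewrite [RHS]row_sum_delta mulmx_sumr; apply: eq_bigr => i _.
by rewrite -scalemxAr cyc_rowM mul1r cyc_row_basis.
Qed.

(** An element of degree 0 is an E-combination of matrices [cyc_mul c], and all of these commute
    with elements of degree 0. *)
Lemma graded0_comm A B : graded 0 A -> graded 0 B -> A * B = B * A.
Proof.
move=> gA gB.
have -> : B = cyc_of_row (cyc_row 1 *m B).
  by apply: graded0_row1_inj; rewrite ?cyc_of_rowK //; apply: cyc_of_row_graded.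
rewrite mulr_sumr mulr_suml; apply: eq_bigr => i _.
by rewrite -scalerAr -scalerAl gA.
Qed.

Lemma cyc_row1_shift : cyc_row 1 *m cyc_shift = cyc_row 1.
Proof. by rewrite cyc_row_shift rmorph1. Qed.

(** The equations have coefficients in Fq, so their solutions over E are spanned by those over Fq.
    The latter are coordinates of sigma-fixed elements of L, that is, of scalars. *)
Lemma cyc_shift_fixed (u : 'rV[E]_n) :
  u *m cyc_shift = u -> exists x, u = x *: cyc_row 1.
Proof.
move=> uS; pose S0 := cyc_lin_mx (sigma^-1)%g - 1%:M.
suffices /sub_rVP[x ux] : (u <= cyc_row 1)%MS by exists x.
apply: (@submx_trans _ _ _ _ _ _ (map_mx j (kermx S0))).
  rewrite map_kermx; apply/sub_kermxP.
  by rewrite map_mxB map_mx1 mulmxBr uS mulmx1 subrr.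
rewrite map_submx; apply/rV_subP => v /sub_kermxP.
rewrite mulmxBr mulmx1; have [c ->] := cyc_coord_surj v.
rewrite cyc_coord_lin -linearB => vc0.
have /eqP : (sigma^-1)%g c - c = 0.
  by apply: cyc_row0; rewrite /cyc_row vc0 map_mx0.
rewrite subr_eq0 => /eqP sc.
have [|a ->] := @gal_fixed_scalar _ _ sigma sigma_gen c.
  by rewrite -{1}sc -galM ?memvf // mulVg gal_id.
by rewrite linearZ scalemx_sub.
Qed.

Lemma cyc_center A : graded 0 A -> A * cyc_shift = cyc_shift * A ->
  exists x, A = x%:M.
Proof.
move=> gA AS; have [|x vA] := @cyc_shift_fixed (cyc_row 1 *m A).
  by rewrite -mulmxA [A *m _]AS mulmxA cyc_row1_shift.
exists x; apply: graded0_row1_inj => // [c|].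
  by rewrite /= -![_ * _ :> 'M_n]/(_ *m _) mul_mx_scalar mul_scalar_mx.
by rewrite vA mul_mx_scalar.
Qed.

(** The power n-1 of the shift is its inverse; since degrees are natural numbers, it is given degree
    n-1 in place of -1. *)
Lemma cyc_shift_inv_graded k : graded (k * n.-1) ((cyc_shift ^+ n.-1) ^+ k).
Proof.
by apply: gradedX; have := gradedX n.-1 cyc_shift_graded; rewrite muln1.
Qed.

Lemma cyc_shiftXK k : cyc_shift ^+ k * (cyc_shift ^+ n.-1) ^+ k = 1.
Proof.
by rewrite -exprMn_comm -?exprS ?cyc_shiftXn ?expr1n //; apply/commrX.
Qed.

Lemma cyc_graded0_mod (k : nat) A : graded (k + k * n.-1) A -> graded 0 A.
Proof.
by apply: eq_graded => //; rewrite dim_L -mulnS mod0n modnMl.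
Qed.

(* P is an average of the y^i (cyc_mul c) S^-i, nonzero for some c by Dedekind. If
   A P = 0 for some A <> 0 in the centralizer of L, then averaging A yields a
   nonzero scalar that also kills P. *)
Lemma cyc_hilbert90 (y : 'M[E]_n) : graded 1 y -> y ^+ n = 1 ->
  exists P, [/\ P \is a GRing.unit, graded 0 P & y * P = P * cyc_shift].
Proof.
move=> gy yn; pose S' := cyc_shift ^+ n.-1.
have gyX k : graded k (y ^+ k) by have := gradedX k gy; rewrite muln1.
have gSX k : graded k (cyc_shift ^+ k).
  by have := gradedX k cyc_shift_graded; rewrite muln1.
have S'S : S' * cyc_shift = 1 by rewrite -exprSr cyc_shiftXn.
have iter_n a : iter n sigma a = a by rewrite -[RHS](iter_gal_dim sigma) dim_L.
pose m := (cyc_mul : {rmorphism L -> 'M[E]_n}).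
pose Pc c := \sum_(i < n) m (iter i sigma c) * (y ^+ i * S' ^+ i).
have [c nz_P] : exists c, Pc c != 0.
  apply: contrapT => /forallNP P0; have := oner_neq0 'M[E]_n; rewrite -{1}[1]mul1r.
  have := @dedekind _ _ _ sigma_gen _ m (fun i => y ^+ i * S' ^+ i) _ 0.
  rewrite dim_L expr0 => -> //; first by rewrite eqxx.
  by move=> c; apply/eqP; apply: contrapT => /negP; apply: P0.
set P := Pc c in nz_P.
have gP : graded 0 P.
  apply: graded_sum => i _; rewrite -[0%N]addn0.
  apply: gradedM; first exact: graded_scalar.
  by apply: cyc_graded0_mod; apply/gradedM/cyc_shift_inv_graded.
have yP : y * P = P * cyc_shift.
  (* The map A |-> y A S' sends each term of the average to the next one, cyclically because y^n =
     S'^n = 1. *)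
  suffices: y * P * S' = P by move=> e; rewrite -[in RHS]e -!mulrA S'S mulr1.
  pose t i := m (iter i sigma c) * (y ^+ i * S' ^+ i).
  have t0n : t n = t 0.
    rewrite /t yn /S' -exprM mulnC exprM cyc_shiftXn expr1n mulr1.
    by rewrite iter_n.
  have -> : y * P * S' = \sum_(i < n) t i.+1.
    rewrite /P /Pc mulr_sumr mulr_suml; apply: eq_bigr => i _.
    by rewrite /t exprS exprSr !mulrA gy.
  exact: sum_cyclic_shift t0n.
have yPX k : y ^+ k * P = P * cyc_shift ^+ k.
  elim: k => [|k IHk]; first by rewrite mul1r mulr1.
  by rewrite exprS -mulrA IHk mulrA yP -mulrA -exprS.
exists P; split=> //; apply: contraT; rewrite -[P \is a _]/(P \in unitmx).
rewrite -row_free_unit -kermx_eq0 => /rowV0Pn[u /sub_kermxP uP nz_u].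
(* A singular P kills a nonzero row u on the left; A is the element of the centralizer of L with
   that row. *)
pose A := cyc_of_row u; have gA : graded 0 A by apply: cyc_of_row_graded.
have AP : A * P = 0.
  apply: graded0_row1_inj; first exact: (gradedM gA gP).
    by move=> d; rewrite mul0r mulr0.
  by rewrite mulmxA cyc_of_rowK uP mulmx0.
pose Qc d := \sum_(i < n) m (iter i sigma d) * (cyc_shift ^+ i * A * S' ^+ i).
have [d nz_Q] : exists d, Qc d != 0.
  apply: contrapT => /forallNP Q0; have : A == 0.
    have := @dedekind _ _ _ sigma_gen _ m (fun i => cyc_shift ^+ i * A * S' ^+ i) _ 0.
    rewrite dim_L !expr0 mul1r mulr1 => -> //.
    by move=> d; apply/eqP; apply: contrapT => /negP; apply: Q0.
  move/eqP => A0; case/eqP: nz_u; rewrite -[u]cyc_of_rowK -/A A0 mulmx0 //.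
set Q := Qc d in nz_Q.
have QP : Q * P = 0.
  (* Writing P as y^i P S'^i puts the degree 0 element S'^i y^i next to A. The two commute, which
     brings A in front of P. *)
  rewrite mulr_suml big1 // => i _; suffices -> : P = y ^+ i * P * S' ^+ i.
    have AC : A * (S' ^+ i * y ^+ i) = S' ^+ i * y ^+ i * A.
      apply: graded0_comm => //; apply: (@cyc_graded0_mod i); rewrite addnC.
      by apply: gradedM (gyX i); apply: cyc_shift_inv_graded.
    rewrite -!mulrA [S' ^+ i * (y ^+ i * _)]mulrA [A * _]mulrA AC -!mulrA [A * _]mulrA AP.
    by rewrite mul0r !mulr0.
  by rewrite yPX -mulrA cyc_shiftXK mulr1.
have gQ : graded 0 Q.
  apply: graded_sum => i _; rewrite -[0%N]addn0.
  apply: gradedM; first exact: graded_scalar.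
  apply: (@cyc_graded0_mod i); rewrite -[X in (X + _)%N]addn0.
  by apply: gradedM (cyc_shift_inv_graded i); apply: gradedM.
have QS : Q * cyc_shift = cyc_shift * Q.
  suffices e: cyc_shift * Q * S' = Q by rewrite -{1}e -!mulrA S'S mulr1.
  pose t i := m (iter i sigma d) * (cyc_shift ^+ i * A * S' ^+ i).
  have t0n : t n = t 0.
    rewrite /t cyc_shiftXn /S' -exprM mulnC exprM cyc_shiftXn expr1n mulr1.
    by rewrite iter_n.
  have -> : cyc_shift * Q * S' = \sum_(i < n) t i.+1.
    rewrite /Q /Qc mulr_sumr mulr_suml; apply: eq_bigr => i _.
    by rewrite /t exprS exprSr !mulrA cyc_shift_graded.
  exact: sum_cyclic_shift t0n.
have [x Qx] := cyc_center gQ QS; case/eqP: nz_P.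
have nz_x : x != 0 by apply: contraNneq nz_Q => x0; rewrite Qx x0 raddf0.
have : x *: P = 0 by rewrite -mul_scalar_mx -Qx.
by move/eqP; rewrite scaler_eq0 (negPf nz_x) => /eqP.
Qed.

End Splitting.

(** * Surjectivity of the norm by counting *)

Section NormSurjective.
Variables (Fq : finFieldType) (L : splittingFieldType Fq) (sigma : gal_of {:L}).
Hypothesis sigma_gen : generator 'Gal({:L} / 1)%g sigma.
Variables (n' : nat).
Let n := n'.+1.
Hypothesis dim_L : \dim {:L} = n.
Variables (E : finFieldType) (j : {rmorphism Fq -> E}).

Local Notation shift := (cyc_shift sigma dim_L j).
Local Notation m := (cyc_mul dim_L j : {rmorphism _ -> _}).
Local Notation graded := (@graded _ L sigma _ m).

Lemma cyc_shift_unit : shift \is a GRing.unit.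
Proof.
apply/unitrP; exists (shift ^+ n.-1).
by split; [rewrite -exprSr | rewrite -exprS]; rewrite cyc_shiftXn.
Qed.

Lemma cyc_shiftVE : shift^-1 = shift ^+ n.-1.
Proof.
by rewrite -[RHS](mulKr cyc_shift_unit) -exprS cyc_shiftXn // mulr1.
Qed.

Let GL : finGroupType := {unit 'M[E]_n'.+1}.
Let gv (u : GL) : 'M[E]_n'.+1 := val (u : {unit _}).
Let gvM u v : gv (u * v)%g = gv u * gv v. Proof. by []. Qed.
Let gvV u : gv u^-1%g = (gv u)^-1. Proof. by []. Qed.
Let gv_inj : injective gv. Proof. exact: val_inj. Qed.
Let gv_unit u : gv u \is a GRing.unit. Proof. exact: (valP (u : {unit _})). Qed.

Let s : GL := FinRing.unit _ cyc_shift_unit.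
Let gvs : gv s = shift. Proof. by []. Qed.
Let C : {set GL} := [set u : GL | `[< graded 0 (gv u) >]].

Let CP (u : GL) : reflect (graded 0 (gv u)) (u \in C).
Proof. by rewrite inE; apply: asboolP. Qed.

Let C_group_set : group_set C.
Proof.
apply/group_setP; split; first by apply/CP; apply: graded1.
by move=> u v /CP gu /CP hv; apply/CP; apply: (gradedM gu hv).
Qed.
Let D : {group GL} := group C_group_set.

Let conj_s (u : GL) : u \in D -> (u ^ s^-1)%g \in D.
Proof.
move=> /CP gu; apply/CP; rewrite conjgE invgK !gvM gvV gvs.
rewrite -/n cyc_shiftVE; apply: (@cyc_graded0_mod _ _ _ sigma_gen _ dim_L _ _ 1).
rewrite -[X in (X + _)%N]addn0 mul1n mulrA; apply: gradedM.
  by apply: gradedM => //; apply: cyc_shift_graded.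
by have := gradedX n.-1 (cyc_shift_graded sigma dim_L j); rewrite muln1.
Qed.

Let commD : {in D &, commutative mulg}.
Proof.
move=> u v /CP gu /CP hv; apply: gv_inj; rewrite !gvM.
exact: (graded0_comm gu hv).
Qed.

(** Conjugation by the shift is the Galois action on [D], the unit group of L (x) E. The map [f] is
    the coboundary u |-> u^-1 sigma(u), and [cyc_norm n] below is the norm. *)
Let f (u : GL) := (u^-1 * u ^ s^-1)%g.
Fixpoint cyc_norm i (u : GL) : GL := 
  if i is i'.+1 then (u * cyc_norm i' u ^ s^-1)%g else 1%g.

Let f_in u : u \in D -> f u \in D.
Proof. by move=> Du; rewrite /f groupM ?groupV ?conj_s. Qed.

Let norm_in i u : u \in D -> cyc_norm i u \in D.
Proof. by move=> Du; elim: i => [|i IHi]; [exact: group1 | apply: groupM => //; exact: conj_s]. Qed.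

Let f_morph : {in D &, {morph f : u v / u * v}%g}.
Proof.
move=> u v Du Dv; rewrite {1}/f conjMg invMg -(mulgA v^-1%g) (mulgA u^-1%g).
by rewrite mulgA (@commD v^-1%g (f u)) ?groupV ?f_in // /f !mulgA.
Qed.

Let norm_morph i : {in D &, {morph cyc_norm i : u v / u * v}%g}.
Proof.
move=> u v Du Dv; elim: i => [|i IHi] /=; first by rewrite mulg1.
rewrite IHi conjMg; have DA := conj_s (norm_in i Du).
set A := (cyc_norm i u ^ _)%g in DA *; set B := (cyc_norm i v ^ _)%g.
by rewrite (mulgA (u * v)%g) -(mulgA u v A) (commD Dv DA) !mulgA.
Qed.

(** Collecting the shifts of (u S)^i on the right leaves the partial norm of u. As S^n = 1, the norm
    of u is (u S)^n. *)
Let val_norm i u : gv (cyc_norm i u) * shift ^+ i = (gv u * shift) ^+ i.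
Proof.
elim: i => [|i IHi] /=; first by rewrite !expr0 mulr1.
rewrite conjgE invgK !gvM gvV gvs [RHS]exprS -IHi !exprS.
by rewrite -!mulrA (mulKr cyc_shift_unit).
Qed.

Let val_normn u : gv (cyc_norm n u) = (gv u * shift) ^+ n.
Proof. by rewrite -val_norm cyc_shiftXn // mulr1. Qed.

Let fM := Morphism f_morph.
Let NM := Morphism (@norm_morph n).

Let ker_fP u : reflect (u \in D /\ gv u * shift = shift * gv u) (u \in 'ker fM)%g.
Proof.
apply: (iffP idP) => [/morphpreP[Du /set1P /= fu]|[Du us]].
  split=> //; have {fu} : (u ^ s^-1)%g = u by rewrite -(mulKVg u (u ^ _)%g) -/(f u) fu mulg1.
  move=> /conjg_fixP /commgP /commuteV /(congr1 gv); rewrite invgK.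
  by rewrite !gvM gvs.
apply/morphpreP; split=> //; apply/set1P; rewrite /= /f.
suffices -> : (u ^ s^-1)%g = u by rewrite mulVg.
apply: gv_inj; rewrite conjgE invgK !gvM gvV gvs mulrA -us mulrK //.
exact: cyc_shift_unit.
Qed.

(* Hilbert 90 gives 'ker N \subset f @* D; comparing orders turns this into
   surjectivity of the norm onto the centre. *)
Let norm_image : (NM @* D = 'ker fM)%g.
Proof.
apply: morphim_eq_ker.
  apply/fintype.subsetP => u /morphpreP[Du /set1P /= /(congr1 gv)]; rewrite val_normn => un.
  have [||P [P_unit gP yP]] := @cyc_hilbert90 _ _ _ sigma_gen _ dim_L _ j (gv u * shift).
  - by rewrite -[1%N]add0n; apply: gradedM; [apply/CP | apply: cyc_shift_graded].
  - exact: un.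
  pose P' : GL := FinRing.unit _ P_unit.
  have DP' : P' \in D by apply/CP.
  have DV : (P'^-1)%g \in D by rewrite groupV.
  apply/morphimP; exists (P'^-1)%g => //; rewrite -[fM _]/(f _).
  rewrite /f invgK conjVg; apply: (canRL (mulgK _)); apply: gv_inj.
  rewrite gvM conjgE invgK !gvM gvV gvs -[gv P']/P.
  by rewrite !mulrA yP (mulrK cyc_shift_unit).
apply/fintype.subsetP => _ /morphimP[u _ Du ->]; apply/ker_fP => /=.
split; first exact: (norm_in n Du).
have /CP gu := Du; have Un := gv_unit u.
have e1 : gv (cyc_norm n u) * (gv u * shift) = (gv u * shift) * gv (cyc_norm n u).
  by rewrite val_normn -exprS -exprSr.
have e2 : gv (cyc_norm n u) * gv u = gv u * gv (cyc_norm n u).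
  by rewrite -!gvM commD // norm_in.
by move: e1; rewrite mulrA e2 -!mulrA => /(mulrI Un).
Qed.

(** A nonzero scalar commutes with L and with the shift S, so it lies in the kernel of the
    coboundary and is the norm of some u; take y = u S. *)
Lemma cyc_norm_surj (x : E) : x != 0 -> exists y, graded 1 y /\ y ^+ n = x%:M.
Proof.
move=> nz_x; have xU : (x%:M : 'M[E]_n'.+1) \is a GRing.unit.
  by rewrite -[_ \is a _]/(_ \in unitmx) unitmxE det_scalar unitfE expf_neq0.
have : FinRing.unit _ xU \in ('ker fM)%g.
  apply/ker_fP; split; first apply/CP => c /=.
    by rewrite -![_ * _ :> 'M_n]/(_ *m _) mul_mx_scalar mul_scalar_mx.
  by rewrite /= -![_ * _ :> 'M_n]/(_ *m _) mul_mx_scalar mul_scalar_mx.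
rewrite -norm_image => /morphimP[u _ Du /(congr1 gv) e].
exists (gv u * shift); split; last by rewrite -val_normn; apply: esym e.
by rewrite -[1%N]add0n; apply: gradedM; [apply/CP | apply: cyc_shift_graded].
Qed.

End NormSurjective.

(** * Expansions in powers of the generator *)

Lemma big_ord_mul (V : nmodType) s n (f : nat -> V) :
  \sum_(i < (s * n)%N) f i = \sum_(t < s) \sum_(r < n) f (t * n + r)%N.
Proof.
elim: s => [|s IHs]; first by rewrite !big_ord0.
rewrite mulSnr big_split_ord /= IHs [RHS]big_ord_recr /=; congr (_ + _).
Qed.

Section Expansion.
Variables (Fq : finFieldType) (L : splittingFieldType Fq) (sigma : gal_of {:L}).
Variables (M : pzRingType) (iota : {rmorphism L -> M}) (x : M).

Definition expansion N (a : nat -> L) : M := \sum_(i < N) iota (a i) * x ^+ i.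

Definition free_powers N :=
  forall a, expansion N a = 0 -> forall i, (i < N)%N -> a i = 0.

(** This is F(x^n) = 0, with the coefficients read in M through [iota]. *)
Definition poly_relation (F : {poly Fq}) : Prop :=
  \sum_(i < size F) iota (F`_i)%:A * (x ^+ \dim {:L}) ^+ i = 0.

Lemma expansion0 N : expansion N (fun=> 0) = 0.
Proof. by rewrite /expansion big1 // => i _; rewrite rmorph0 mul0r. Qed.

Lemma expansionD N a b : 
  expansion N a + expansion N b = expansion N (fun i => a i + b i).
Proof. by rewrite -big_split; apply: eq_bigr => i _; rewrite rmorphD mulrDl. Qed.

Lemma expansionB N a b : 
  expansion N a - expansion N b = expansion N (fun i => a i - b i).
Proof. by rewrite -sumrB; apply: eq_bigr => i _; rewrite rmorphB mulrBl. Qed.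

Lemma expansionZ N c a : iota c * expansion N a = expansion N (fun i => c * a i).
Proof. by rewrite mulr_sumr; apply: eq_bigr => i _; rewrite rmorphM mulrA. Qed.

Lemma expansionX N c i : (i < N)%N ->
  iota c * x ^+ i = expansion N (fun k => c *+ (k == i)).
Proof.
move=> ltiN; rewrite /expansion (bigD1 (Ordinal ltiN)) //= eqxx mulr1n big1 ?addr0 //.
by move=> k /negPf; rewrite -val_eqE /= => ->; rewrite mulr0n rmorph0 mul0r.
Qed.

Lemma expansion_widen N N' a : (N <= N')%N -> 
  expansion N a = expansion N' (fun i => a i *+ (i < N)%N).
Proof.
move=> le_N; rewrite /expansion (big_ord_widen _ (fun i => iota (a i) * x ^+ i) le_N).
rewrite big_mkcond; apply: eq_bigr => i _; case: ifP => _ //.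
by rewrite mulr0n rmorph0 mul0r.
Qed.

Lemma eq_expansion N a b : (forall i, (i < N)%N -> a i = b i) ->
  expansion N a = expansion N b.
Proof. by move=> ab; apply: eq_bigr => i _; rewrite ab. Qed.

Lemma free_powers_inj N a b : free_powers N -> expansion N a = expansion N b ->
  forall i, (i < N)%N -> a i = b i.
Proof.
move=> fr /eqP; rewrite -subr_eq0 expansionB => /eqP ab0 i ltiN.
by apply/eqP; rewrite -subr_eq0; apply/eqP/(fr _ ab0).
Qed.

(** A polynomial in x^n is an expansion in x supported on the multiples of n; this lets freeness of
    the powers of x act on relations. *)
Lemma relation_expansion s (h : nat -> Fq) :
  \sum_(i < s) iota (h i)%:A * (x ^+ \dim {:L}) ^+ i =
  expansion (s * \dim {:L})%N
    (fun i => (h (i %/ \dim {:L})%N)%:A *+ (i %% \dim {:L} == 0)%N).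
Proof.
have n_gt0 : (0 < \dim {:L})%N := adim_gt0 {:L}; set n := \dim {:L} in n_gt0 *.
pose a i : L := (h (i %/ n)%N)%:A *+ (i %% n == 0)%N.
rewrite /expansion (big_ord_mul _ _ (fun i => iota (a i) * x ^+ i)).
apply: eq_bigr => t _; rewrite /a (bigD1 (Ordinal n_gt0)) //= addn0 modnMl mulnK //.
rewrite big1 ?addr0 => [|r]; first by rewrite mulr1n -exprM mulnC.
rewrite -val_eqE /= => /negPf r0.
by rewrite modnMDl modn_small // r0 mulr0n rmorph0 mul0r.
Qed.

Hypothesis gx : graded sigma iota 1 x.

Lemma gradedX1 i : graded sigma iota i (x ^+ i).
Proof. by have := gradedX i gx; rewrite muln1. Qed.

Lemma mulx_expansion N a :
  x * expansion N a = \sum_(i < N) iota (sigma (a i)) * x ^+ i.+1.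
Proof.
by rewrite mulr_sumr; apply: eq_bigr => i _; rewrite mulrA gx -mulrA -exprS.
Qed.

(** Multiplication by x raises every exponent by one; only the top term reaches x^N, which is
    rewritten in lower powers. *)
Lemma expansion_closed N y : (0 < N)%N -> (exists b, x ^+ N = expansion N b) ->
  (exists a, y = expansion N a) -> exists a, x * y = expansion N a.
Proof.
case: N => // N _ [b xN] [a ->]; rewrite mulx_expansion big_ord_recr /= xN expansionZ.
exists (fun i => (if i is i'.+1 then sigma (a i') else 0) + sigma (a N) * b i).
rewrite -expansionD; congr (_ + _).
by rewrite /expansion big_ord_recl /= rmorph0 mul0r add0r.
Qed.

Section Relation.
Variables (F : {poly Fq}) (s : nat).
Hypotheses (F_monic : F \is monic) (F_deg : size F = s.+1).
Let n := \dim {:L}.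

Lemma dim_gt0 : (0 < n)%N.
Proof. exact: (adim_gt0 {:L}). Qed.

Lemma poly_relation_top : poly_relation F -> exists b, x ^+ (s * n)%N = expansion (s * n)%N b.
Proof.
rewrite /poly_relation F_deg big_ord_recr /= => /eqP; rewrite addrC addr_eq0 => /eqP.
have -> : F`_s = 1 by move: F_monic; rewrite monicE /lead_coef F_deg => /eqP.
rewrite scale1r rmorph1 mul1r -exprM mulnC => ->; rewrite -mulN1r mulr_sumr.
have eF (i : 'I_s) : -1 * (iota (F`_i)%:A * (x ^+ n) ^+ i) = iota (- F`_i)%:A * (x ^+ n) ^+ i.
  by rewrite mulN1r scaleNr rmorphN mulNr.
rewrite (eq_bigr _ (fun i _ => eF i)) (relation_expansion s (fun i => - F`_i)).
by eexists.
Qed.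

End Relation.
End Expansion.

(** * The powers of X as an L-basis of R_F *)

Section SkewQuotientMaps.
Variables (Fq : finFieldType) (L : splittingFieldType Fq) (sigma : gal_of {:L}).
Variables (F : {poly Fq}) (s : nat).
Hypotheses (F_monic : F \is monic) (F_deg : size F = s.+1).
Let n := \dim {:L}.

HB.instance Definition _ :=
  GRing.isZmodMorphism.Build (skewpoly sigma) (RF sigma F) (RFclass sigma F)
    (@tsclass_is_zmod _ (RF_ideal (sigma := sigma) F)).
HB.instance Definition _ :=
  GRing.isMonoidMorphism.Build (skewpoly sigma) (RF sigma F) (RFclass sigma F)
    (@tsclass_is_monoid _ (RF_ideal (sigma := sigma) F)).

Definition RFscalar : L -> RF sigma F := RFclass sigma F \o skewC sigma.
Definition RFx : RF sigma F := RFclass sigma F (skewX sigma).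

Lemma RFscalar_is_zmod : zmod_morphism RFscalar.
Proof. by move=> c d; rewrite /RFscalar /= !raddfB. Qed.
Lemma RFscalar_is_monoid : monoid_morphism RFscalar.
Proof. by split=> [|c d]; rewrite /RFscalar /= ?rmorph1 // !rmorphM. Qed.
HB.instance Definition _ :=
  GRing.isZmodMorphism.Build L (RF sigma F) RFscalar RFscalar_is_zmod.
HB.instance Definition _ :=
  GRing.isMonoidMorphism.Build L (RF sigma F) RFscalar RFscalar_is_monoid.

Lemma RFclass_expansion N (a : nat -> L) :
  RFclass sigma F (\sum_(i < N) skewC sigma (a i) * skewX sigma ^+ i) =
  expansion (RFscalar : {rmorphism _ -> _}) RFx N a.
Proof.
rewrite raddf_sum; apply: eq_bigr => i _ /=.
by rewrite rmorphM rmorphXn.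
Qed.

Lemma RFx_graded : graded sigma (RFscalar : {rmorphism _ -> _}) 1 RFx.
Proof.
move=> c; rewrite -(rmorphM (RFclass sigma F) (skewX sigma) (skewC sigma c)).
by rewrite skewXC rmorphM.
Qed.

Lemma RFclass_eq0 p : RFclass sigma F p = 0 -> exists r, p = r * eval_skewXn sigma n F.
Proof.
move=> p0; suffices : p - 0 \in RF_ideal F by rewrite subr0 => /asboolP.
by apply/tsclassP; rewrite raddf0; apply: p0.
Qed.

Lemma RF_relation : poly_relation (RFscalar : {rmorphism _ -> _}) RFx F.
Proof.
have /tsclassP e : eval_skewXn sigma n F - 0 \in RF_ideal F.
  by rewrite subr0; apply/asboolP; exists 1; rewrite mul1r.
have {e} : RFclass sigma F (eval_skewXn sigma n F) = RFclass sigma F 0 := e.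
rewrite raddf0 raddf_sum /poly_relation => e; rewrite -[RHS]e; apply: eq_bigr => i _ /=.
by rewrite rmorphM !rmorphXn.
Qed.

(** The span contains 1 and is stable under left multiplication by L and by the class of X, hence
    contains the class of every skew polynomial. *)
Lemma RF_spanned (y : RF sigma F) :
  exists a, y = expansion (RFscalar : {rmorphism _ -> _}) RFx (s * n)%N a.
Proof.
pose T y := exists a, y = expansion (RFscalar : {rmorphism _ -> _}) RFx (s * n)%N a.
have T0 : T 0 by exists (fun=> 0); rewrite expansion0.
have TD u v : T u -> T v -> T (u + v).
  by move=> [a ->] [b ->]; rewrite expansionD; eexists.
have TZ c u : T u -> T (RFscalar c * u).
  by move=> [a ->]; rewrite expansionZ; eexists.
(* For s = 0 the monic F is the constant 1, so the quotient is the zero ring. *)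
have [s0|s_gt0] := posnP s.
  have y0 : 1 = 0 :> RF sigma F.
    have := RF_relation; rewrite /poly_relation F_deg s0 big_ord_recl big_ord0 addr0.
    move: F_monic; rewrite monicE /lead_coef F_deg s0 => /eqP ->.
    by rewrite scale1r rmorph1 mul1r.
  by rewrite -[y]mul1r y0 mul0r; apply: T0.
have sn_gt0 : (0 < s * n)%N by rewrite muln_gt0 s_gt0 dim_gt0.
have topX := poly_relation_top F_monic F_deg RF_relation.
have TX u : T u -> T (RFx * u) := expansion_closed RFx_graded sn_gt0 topX.
have T1 : T 1.
  have := expansionX (RFscalar : {rmorphism _ -> _}) RFx 1 sn_gt0.
  by rewrite rmorph1 mul1r expr0 => ->; eexists.
have TXi i : T (RFx ^+ i).
  by elim: i => [|i IHi]; rewrite ?exprS //; apply: TX.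
have -> : y = RFclass sigma F (tsrep y) by rewrite [RHS]tsrepK.
rewrite (skewpolyE (tsrep y)) raddf_sum /=.
elim/big_rec: _ => [|i u _ Tu]; first exact: T0.
by apply: TD => //; rewrite rmorphM rmorphXn; apply: TZ.
Qed.

Lemma skewC_mulE c (q : skewpoly sigma) : skewC sigma c * q = c *: (q : {poly L}).
Proof.
change (skew_mul sigma c%:P q = c *: (q : {poly L})).
by rewrite -[c%:P]mulr1 mul_polyC skew_mulZl skew_mul1l.
Qed.

Lemma skewXnE i : skewX sigma ^+ i = 'X^i :> {poly L}.
Proof.
by elim: i => // i IH; rewrite exprS skewX_mulE IH rmorphXn /= map_polyX -exprSr.
Qed.

Lemma coef_skew_sum N (a : nat -> L) k :
  (\sum_(i < N) skewC sigma (a i) * skewX sigma ^+ i : {poly L})`_k =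
  if (k < N)%N then a k else 0.
Proof.
rewrite coef_sum; under eq_bigr do rewrite skewC_mulE skewXnE coefZ coefXn.
case: ltnP => [ltk|lek].
  rewrite (bigD1 (Ordinal ltk)) //= eqxx mulr1 big1 ?addr0 // => i.
  by rewrite -val_eqE /= eq_sym => /negPf ->; rewrite mulr0.
by rewrite big1 // => i _; rewrite gtn_eqF ?mulr0 // (leq_trans _ lek).
Qed.

Lemma coef_eval_skewXn k : (s * n <= k)%N ->
  (eval_skewXn sigma n F : {poly L})`_k = (k == s * n)%N%:R.
Proof.
move=> le_k; have n_gt0 : (0 < n)%N := dim_gt0 L.
have -> : eval_skewXn sigma n F = \sum_(i < size F) (F`_i)%:A *: 'X^(i * n) :> {poly L}.
  apply: eq_bigr => i _; rewrite -exprM mulnC skewC_mulE; congr (_ *: _).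
  exact: skewXnE.
rewrite coef_sum F_deg big_ord_recr /= big1 => [|i _]; last first.
  rewrite coefZ coefXn gtn_eqF ?mulr0 //; apply: leq_trans le_k.
  by rewrite ltn_pmul2r.
rewrite add0r coefZ coefXn.
have -> : F`_s = 1 by move: F_monic; rewrite monicE /lead_coef F_deg => /eqP.
by rewrite scale1r mul1r.
Qed.

Lemma coef_iter_skewT i (q : {poly L}) k :
  (iter i (skewT sigma) q)`_k = if (k < i)%N then 0 else iter i sigma q`_(k - i).
Proof.
elim: i k => [|i IHi] k /=; first by rewrite subn0.
rewrite {1}/skewT coefMX; case: k => [|k] //=.
by rewrite coef_map /= IHi ltnS subSS; case: ifP => _ //; rewrite rmorph0.
Qed.

(** For r <> 0 of degree d, the coefficient of r F(X^n) at d + sn is the leading coefficient of r.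
    So no nonzero element of the ideal has degree below sn. *)
Lemma RF_free : free_powers (RFscalar : {rmorphism _ -> _}) RFx (s * n)%N.
Proof.
move=> a; rewrite -RFclass_expansion => /RFclass_eq0[r Dp] i lt_i.
suffices r0 : r = 0.
  by have := coef_skew_sum (s * n)%N a i; rewrite Dp r0 mul0r coef0 lt_i.
apply/eqP; apply: contraT => nz_r; pose d := (size (r : {poly L})).-1.
have szr : size (r : {poly L}) = d.+1 by rewrite prednK // size_poly_gt0.
have := coef_skew_sum (s * n)%N a (d + s * n)%N.
rewrite ltnNge leq_addl Dp -[r * _]/(skew_mul sigma r (eval_skewXn sigma n F)).
rewrite skew_mulE /skew_act szr big_ord_recr /= coefD coef_sum big1 => [|j _]; last first.
  rewrite coefZ coef_iter_skewT ltnNge (leq_trans (ltnW (ltn_ord j)) (leq_addr _ _)) /=.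
  rewrite coef_eval_skewXn ?leq_subRL ?(leq_trans (ltnW (ltn_ord j)) (leq_addr _ _))
    ?leq_add2r ?(ltnW (ltn_ord j)) //.
  rewrite gtn_eqF ?ltn_subRL ?ltn_add2r // iter_galE; first by rewrite mulr0n rmorph0 mulr0.
rewrite add0r coefZ coef_iter_skewT ltnNge leq_addr /= addKn coef_eval_skewXn // eqxx.
rewrite iter_galE rmorph1 mulr1 => /eqP; rewrite -[_`_d]/(lead_coef (r : {poly L})).
by rewrite lead_coef_eq0 (negPf nz_r).
Qed.

End SkewQuotientMaps.

(** * Evaluation of skew polynomials *)

Section SkewEvaluation.
Variables (Fq : finFieldType) (L : splittingFieldType Fq) (sigma : gal_of {:L}).
Variables (M : pzRingType) (iota : {rmorphism L -> M}) (x : M).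
Hypothesis gx : graded sigma iota 1 x.

Definition skew_eval (p : skewpoly sigma) : M :=
  expansion iota x (size (p : {poly L})) (fun i => p`_i).

Lemma skew_eval_wide N (p : skewpoly sigma) : (size (p : {poly L}) <= N)%N ->
  skew_eval p = expansion iota x N (fun i => p`_i).
Proof.
move=> le_N; rewrite /skew_eval (expansion_widen _ _ _ le_N).
apply: eq_expansion => i _; case: ltnP => [_|/leq_sizeP/(_ _ (leqnn _)) ->].
  by rewrite mulr1n.
by rewrite mulr0n.
Qed.

Lemma skew_eval_is_zmod : zmod_morphism skew_eval.
Proof.
move=> p q; pose N := maxn (size (p : {poly L})) (size (q : {poly L})).
rewrite !(@skew_eval_wide N) ?leq_maxl ?leq_maxr ?size_polyD //.
  by rewrite expansionB; apply: eq_expansion => i _; rewrite coefB.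
by rewrite (leq_trans (size_polyD _ _)) // size_polyN.
Qed.

HB.instance Definition _ :=
  GRing.isZmodMorphism.Build (skewpoly sigma) M skew_eval skew_eval_is_zmod.

Lemma skew_evalZ c (p : {poly L}) : skew_eval (c *: p) = iota c * skew_eval p.
Proof.
rewrite (@skew_eval_wide (size p)) ?size_scale_leq // expansionZ.
by apply: eq_expansion => i _; rewrite coefZ.
Qed.

Lemma skew_evalT (p : {poly L}) : skew_eval (skewT sigma p) = x * skew_eval p.
Proof.
have le_size : (size (skewT sigma p) <= (size p).+1)%N.
  apply/leq_sizeP => k; rewrite -[skewT sigma p]/(iter 1 (skewT sigma) p).
  rewrite coef_iter_skewT; case: k => [|k] //; rewrite ltnS => lek.
  by rewrite /= subn1 /= nth_default // rmorph0.
have coefT k : (skewT sigma p)`_k = if (k < 1)%N then 0 else sigma p`_(k - 1).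
  exact: (coef_iter_skewT sigma 1 p k).
rewrite (skew_eval_wide le_size) (mulx_expansion gx) /expansion big_ord_recl.
rewrite coefT rmorph0 mul0r add0r; apply: eq_bigr => i _.
by rewrite coefT subn1.
Qed.

Lemma skew_eval1 : skew_eval 1 = 1.
Proof.
by rewrite /skew_eval /expansion size_poly1 big_ord1 coef1 rmorph1 mulr1.
Qed.

Lemma skew_eval_is_monoid : monoid_morphism skew_eval.
Proof.
split=> [|p q]; first exact: skew_eval1.
rewrite -[p * q]/(skew_mul sigma p q) skew_mulE /skew_act.
rewrite (raddf_sum skew_eval) /skew_eval -/skew_eval mulr_suml.
apply: eq_bigr => i _; rewrite [LHS]skew_evalZ -mulrA; congr (_ * _).
elim: (nat_of_ord i) => [|k IHk] /=; first by rewrite mul1r.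
by rewrite skew_evalT IHk mulrA exprS.
Qed.

HB.instance Definition _ :=
  GRing.isMonoidMorphism.Build (skewpoly sigma) M skew_eval skew_eval_is_monoid.

Lemma skew_evalC c : skew_eval (skewC sigma c) = iota c.
Proof.
by rewrite -[skewC sigma c]mulr1 skewC_mulE skew_evalZ skew_eval1 mulr1.
Qed.

Lemma skew_evalX : skew_eval (skewX sigma) = x.
Proof.
have -> : skewX sigma = skewT sigma 1 by rewrite /skewT rmorph1 mul1r.
by rewrite skew_evalT skew_eval1 mulr1.
Qed.

Variable F : {poly Fq}.
Hypothesis relF : poly_relation iota x F.

Definition RF_eval (y : RF sigma F) : M := skew_eval (tsrep y).

Lemma RF_eval_class p : RF_eval (RFclass sigma F p) = skew_eval p.
Proof.
apply/eqP; rewrite -subr_eq0 -raddfB.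
have [|r ->] := @RFclass_eq0 _ _ sigma F (tsrep (RFclass sigma F p) - p).
  by rewrite raddfB; apply/eqP; rewrite subr_eq0; apply/eqP/tsrepK.
rewrite /= rmorphM /=; suffices -> : skew_eval (eval_skewXn sigma (\dim {:L}) F) = 0.
  by rewrite mulr0.
rewrite -[RHS]relF rmorph_sum; apply: eq_bigr => i _ /=.
by rewrite rmorphM !rmorphXn /= skew_evalC skew_evalX.
Qed.

Lemma RF_eval_is_zmod : zmod_morphism RF_eval.
Proof.
move=> u v; have E w : w = RFclass sigma F (tsrep w) by rewrite [RHS]tsrepK.
by rewrite (E u) (E v) -raddfB !RF_eval_class raddfB.
Qed.

Lemma RF_eval_is_monoid : monoid_morphism RF_eval.
Proof.
split=> [|u v].
  by rewrite -[1](rmorph1 (RFclass sigma F)) RF_eval_class rmorph1.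
have E w : w = RFclass sigma F (tsrep w) by rewrite [RHS]tsrepK.
by rewrite (E u) (E v) -rmorphM !RF_eval_class rmorphM.
Qed.

HB.instance Definition _ :=
  GRing.isZmodMorphism.Build (RF sigma F) M RF_eval RF_eval_is_zmod.
HB.instance Definition _ :=
  GRing.isMonoidMorphism.Build (RF sigma F) M RF_eval RF_eval_is_monoid.

(** Universal property of R_F: the twisted commutation rule and F(x^n) = 0 are all that a ring
    morphism out of R_F has to respect. *)
Lemma RF_lift : exists phi : {rmorphism RF sigma F -> M},
  (forall c, phi (RFscalar sigma F c) = iota c) /\ phi (RFx sigma F) = x.
Proof.
exists (RF_eval : {rmorphism _ -> _}); split=> [c|].
  by rewrite /= RF_eval_class skew_evalC.
by rewrite /= RF_eval_class skew_evalX.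
Qed.

End SkewEvaluation.

Section ExpansionMorphism.
Variables (Fq : finFieldType) (L : splittingFieldType Fq) (sigma : gal_of {:L}).
Variables (M M' : pzRingType) (iota : {rmorphism L -> M}) (x : M).
Variables (iota' : {rmorphism L -> M'}) (f : {rmorphism M -> M'}).
Hypothesis f_iota : forall c, f (iota c) = iota' c.

Lemma rmorph_expansion N a : f (expansion iota x N a) = expansion iota' (f x) N a.
Proof.
rewrite rmorph_sum; apply: eq_bigr => i _ /=.
by rewrite rmorphM rmorphXn f_iota.
Qed.

Lemma rmorph_graded i : graded sigma iota i x -> graded sigma iota' i (f x).
Proof. by move=> gx c; rewrite -!f_iota -!rmorphM gx. Qed.

Lemma rmorph_relation F : poly_relation iota x F -> poly_relation iota' (f x) F.
Proof.
move=> rel; rewrite /poly_relation -[RHS](rmorph0 f) -rel rmorph_sum.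
by apply: eq_bigr => i _ /=; rewrite rmorphM !rmorphXn f_iota.
Qed.

Lemma rmorph_free N : injective f -> free_powers iota x N ->
  free_powers iota' (f x) N.
Proof.
move=> f_inj fr a; rewrite -rmorph_expansion => /eqP.
by rewrite -(rmorph0 f) (inj_eq f_inj) => /eqP/fr.
Qed.

End ExpansionMorphism.

(** * Spans of initial powers and degree arguments *)

Section PowerSpan.
Variables (Fq : finFieldType) (L : splittingFieldType Fq) (sigma : gal_of {:L}).
Variables (M : pzRingType) (iota : {rmorphism L -> M}) (x : M).
Hypothesis gx : graded sigma iota 1 x.

(** For K = sk this is the image of the code under the presentation (iota, x). *)
Definition power_span K (y : M) := exists a, y = expansion iota x K a.

Lemma expansion_trunc K N (a : nat -> L) : (K <= N)%N ->
  (forall i, (K <= i < N)%N -> a i = 0) -> expansion iota x N a = expansion iota x K a.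
Proof.
move=> le_KN a0; rewrite (expansion_widen _ _ _ le_KN); apply: eq_expansion => i ltiN.
by case: ltnP => [_|leKi]; rewrite ?mulr1n // a0 ?leKi.
Qed.

Lemma expansionMX N e a : expansion iota x N a * x ^+ e =
  expansion iota x (N + e) (fun i => if (i < e)%N then 0 else a (i - e)%N).
Proof.
rewrite /expansion addnC big_split_ord /= [X in _ = X + _]big1 ?add0r => [|i _]; last first.
  by rewrite /= ltn_ord rmorph0 mul0r.
rewrite mulr_suml; apply: eq_bigr => i _ /=.
by rewrite ltnNge leq_addr /= addKn -mulrA -exprD addnC.
Qed.

Lemma expansionMs N a c : expansion iota x N a * iota c =
  expansion iota x N (fun i => a i * iter i sigma c).
Proof.
rewrite mulr_suml; apply: eq_bigr => i _.
by rewrite -mulrA (gradedX1 gx) mulrA -rmorphM.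
Qed.

Lemma expXM N e a : x ^+ e * expansion iota x N a =
  expansion iota x N (fun i => iter e sigma (a i)) * x ^+ e.
Proof.
rewrite mulr_sumr mulr_suml; apply: eq_bigr => i _.
by rewrite mulrA (gradedX1 gx) -!mulrA -!exprD addnC.
Qed.

Lemma power_spanD K u v : power_span K u -> power_span K v -> power_span K (u + v).
Proof. by move=> [a ->] [b ->]; rewrite expansionD; eexists. Qed.

Lemma power_spanB K u v : power_span K u -> power_span K v -> power_span K (u - v).
Proof. by move=> [a ->] [b ->]; rewrite expansionB; eexists. Qed.

Lemma power_spanZ K c u : power_span K u -> power_span K (iota c * u).
Proof. by move=> [a ->]; rewrite expansionZ; eexists. Qed.

Lemma power_spanMs K c u : power_span K u -> power_span K (u * iota c).
Proof. by move=> [a ->]; rewrite expansionMs; eexists. Qed.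

Lemma power_spanZI K c u : c != 0 -> power_span K (iota c * u) -> power_span K u.
Proof.
move=> nz_c /(power_spanZ c^-1); rewrite mulrA -rmorphM mulVf // rmorph1.
by rewrite mul1r.
Qed.

Lemma power_spanX K i : (i < K)%N -> power_span K (x ^+ i).
Proof.
move=> /(expansionX iota x 1); rewrite rmorph1 mul1r => ->; by eexists.
Qed.

Variable N : nat.
Hypothesis fr : free_powers iota x N.

Lemma power_span_coef K a : (K <= N)%N -> power_span K (expansion iota x N a) ->
  forall i, (K <= i < N)%N -> a i = 0.
Proof.
move=> leKN [b ab] i /andP[leKi ltiN].
rewrite (expansion_widen _ _ _ leKN) in ab.
by rewrite (free_powers_inj fr ab ltiN) ltnNge leKi mulr0n.
Qed.

(** Multiplication by x^e carries a_d to exponent d + e, and no nonzero coefficient reaches exponent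
    N. The exponent d + e lies in [K, N), where elements of the span have coefficient zero. *)
Lemma top_coef_shift K e d a : (K <= N)%N -> (K <= d + e < N)%N ->
    (forall i, (d < i < N)%N -> a i = 0) -> 
  power_span K (expansion iota x N a * x ^+ e) -> a d = 0.
Proof.
move=> leKN /andP[leK ltN] a0; rewrite expansionMX.
rewrite (@expansion_trunc N) ?leq_addr // => [|i /andP[leNi ltiNe]]; last first.
  by rewrite ltnNge (leq_trans _ leNi) ?(leq_trans (leq_addl d e) (ltnW ltN)) //= a0 //; lia.
move=> /(power_span_coef leKN)/(_ (d + e)%N); rewrite leK ltN => /(_ isT).
by rewrite ltnNge leq_addl /= addnK.
Qed.

Lemma max_coef (a : nat -> L) m : (forall i, (m <= i < N)%N -> a i = 0) \/
  exists d, [/\ (m <= d < N)%N, a d != 0 & forall i, (d < i < N)%N -> a i = 0].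
Proof.
have [/existsP[i0 Pi0]|] := boolP [exists i : 'I_N, (m <= i)%N && (a i != 0)].
  right; pose P := [pred i : nat | [&& (m <= i)%N, (i < N)%N & a i != 0]].
  have exP : exists i, P i.
    by exists i0; move: Pi0 => /= /andP[-> ->]; rewrite ltn_ord.
  have ubP i : P i -> (i <= N)%N by move=> /and3P[_ /ltnW].
  case: (ex_maxnP exP ubP) => d /and3P[le_m ltN nz_d] dmax.
  exists d; split; rewrite ?le_m // => i /andP[ltdi ltiN].
  apply: contraTeq ltdi => nz_i; rewrite -leqNgt.
  have [le_mi|/ltnW lt_im] := leqP m i; last exact: leq_trans le_m.
  by rewrite dmax //= le_mi ltiN.
rewrite negb_exists => /forallP a0; left => i /andP[le_mi ltiN].
by apply/eqP; apply: contraNT (a0 (Ordinal ltiN)) => nz; rewrite /= le_mi.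
Qed.

End PowerSpan.

(** * Equivalences between codes *)

Section Idealizers.
Variables (Fq : finFieldType) (L : splittingFieldType Fq) (sigma : gal_of {:L}).
Variables (M : pzRingType) (iota : {rmorphism L -> M}) (x : M).
Hypothesis gx : graded sigma iota 1 x.
Variables (N K : nat).
Hypotheses (K_gt0 : (0 < K)%N) (ltKN : (K < N)%N) (fr : free_powers iota x N).

Let C := power_span iota x K.

Let span_scalar a : (forall i, (0 < i < K)%N -> a i = 0) ->
  expansion iota x K a = iota (a 0%N).
Proof.
move=> a0; rewrite (@expansion_trunc _ _ _ _ _ 1) // /expansion big_ord1.
by rewrite mulr1.
Qed.

Let span1 : C 1.
Proof. exact: (power_spanX iota x K_gt0). Qed.

(** As 1 is in the code, so is y. If y had degree d > 0, then y x^(K-d) would have degree exactly K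
    and leave the code. *)
Lemma left_idealizer y : (forall u, C u -> C (y * u)) -> exists c, y = iota c.
Proof.
move=> yC; have [a ya] := yC 1 span1; rewrite mulr1 in ya.
have [a0|[d [/andP[d_gt0 ltdK] nz_d a0]]] := max_coef K a 1.
  by exists (a 0%N); rewrite ya span_scalar.
case/eqP: nz_d; pose a' i : L := a i *+ (i < K)%N.
have ya' : y = expansion iota x N a' by rewrite ya (expansion_widen _ _ _ (ltnW ltKN)).
suffices: a' d = 0 by rewrite /a' ltdK.
apply: (@top_coef_shift _ _ _ _ _ N fr K (K - d)); rewrite ?(ltnW ltKN) //; first lia.
  move=> i /andP[ltdi ltiN]; rewrite /a'; case: ltnP => // ltiK.
  by rewrite a0 ?ltdi.
by rewrite -ya'; apply/yC/power_spanX; lia.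
Qed.

Lemma right_idealizer y : (forall u, C u -> C (u * y)) -> exists c, y = iota c.
Proof.
move=> yC; have [a ya] := yC 1 span1; rewrite mul1r in ya.
have [a0|[d [/andP[d_gt0 ltdK] nz_d a0]]] := max_coef K a 1.
  by exists (a 0%N); rewrite ya span_scalar.
(* Moving x^(K-d) to the right of y twists the coefficients by sigma^(K-d), which keeps the top one
   nonzero; the degree argument is then the one for the left idealizer. *)
pose a' i : L := iter (K - d) sigma (a i *+ (i < K)%N).
have ya' : x ^+ (K - d) * y = expansion iota x N a' * x ^+ (K - d).
  by rewrite ya (expansion_widen _ _ _ (ltnW ltKN)) (expXM gx).
suffices /eqP: a' d = 0.
  by rewrite /a' ltdK mulr1n iter_galE fmorph_eq0 (negPf nz_d).
apply: (@top_coef_shift _ _ _ _ _ N fr K (K - d)); rewrite ?(ltnW ltKN) //; first lia.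
  move=> i /andP[ltdi ltiN]; rewrite /a' iter_galE; case: ltnP => [ltiK|_].
    by rewrite a0 ?ltdi // mul0rn rmorph0.
  by rewrite mulr0n rmorph0.
by rewrite -ya'; apply/yC/power_spanX; lia.
Qed.

End Idealizers.

Section Equivalence.
Variables (Fq : finFieldType) (L : splittingFieldType Fq) (sigma : gal_of {:L}).
Hypothesis sigma_gen : generator 'Gal({:L} / 1)%g sigma.
Variables (p : nat) (pcharLp : p \in [pchar L]).
Variables (M : unitRingType) (iota1 iota2 : {rmorphism L -> M}) (x1 x2 w : M).
Variables (s k : nat).
Let n := \dim {:L}.
Let N := (s * n)%N.
Let K := (s * k)%N.
Hypotheses (n_ge2 : (2 <= n)%N) (s_ge2 : (2 <= s)%N).
Hypotheses (k_gt0 : (0 < k)%N) (ltkn : (k < n)%N).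
Hypotheses (gx1 : graded sigma iota1 1 x1) (gx2 : graded sigma iota2 1 x2).
Hypotheses (fr1 : free_powers iota1 x1 N) (fr2 : free_powers iota2 x2 N).
Hypothesis sp2 : forall y, exists a, y = expansion iota2 x2 N a.
Hypothesis w_unit : w \is a GRing.unit.
Let C1 := power_span iota1 x1 K.
Let C2 := power_span iota2 x2 K.
Hypothesis codeE : forall y, C1 y <-> C2 (y * w).

Let K_gt0 : (0 < K)%N. Proof. rewrite /K; nia. Qed.
Let ltKN : (K < N)%N. Proof. rewrite /K /N; nia. Qed.
Let ltKN1 : (K.+1 < N)%N. Proof. rewrite /K /N; nia. Qed.
Let leKN := ltnW ltKN.
Let K_ge2 : (2 <= K)%N. Proof. rewrite /K; nia. Qed.

(** The codes C_1 w and C_2 agree, so iota_1(L) lies in the left idealizer iota_2(L). The induced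
    endomorphism of the finite field L is a power of Frobenius. *)
Let iota_frob : exists e, forall c, iota1 c = iota2 (c ^+ (p ^ e)).
Proof.
have im_iota c : exists d, iota1 c = iota2 d.
  apply: (left_idealizer K_gt0 ltKN fr2) => u Cu.
  rewrite -[u](mulrVK w_unit) mulrA; apply/codeE/power_spanZ/codeE.
  by rewrite mulrVK.
have [t tP] := choice im_iota.
have iota2_inj : injective iota2 by apply: fmorph_inj.
have t_zmod : zmod_morphism t.
  by move=> c d; apply: iota2_inj; rewrite -tP !rmorphB !tP.
have t_monoid : monoid_morphism t.
  split=> [|c d]; apply: iota2_inj; first by rewrite -tP !rmorph1.
  by rewrite -tP !rmorphM !tP.
pose tR : {rmorphism L -> L} := HB.pack t
  (GRing.isZmodMorphism.Build _ _ t t_zmod) (GRing.isMonoidMorphism.Build _ _ t t_monoid).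
have [e te] := @finField_endo_frob (finvect_type L) p pcharLp tR.
by exists e => c; rewrite tP; congr (iota2 _); apply: te.
Qed.

Let frob_surj e (c : L) : exists d, c = d ^+ (p ^ e).
Proof.
have f_inj : injective (frob pcharLp e : finvect_type L -> finvect_type L).
  exact: (fmorph_inj (frob pcharLp e : {rmorphism L -> L})).
by have [g _ fg] := injF_bij f_inj; exists (g c); apply/esym/fg.
Qed.

(** The element w iota_2(c) w^-1 stabilizes C_1 on the right, hence lies in iota_1(L), which is
    inside iota_2(L). *)
Let w_twist : exists eta : L -> L, forall c, w * iota2 c = iota2 (eta c) * w.
Proof.
have [e i12] := iota_frob.
suffices /choice[eta etaE] : forall c, exists d, w * iota2 c = iota2 d * w by exists eta.
move=> c.
have [u Cu|d wc] := @right_idealizer _ _ _ _ _ _ gx1 N K K_gt0 ltKN fr1 (w * iota2 c / w).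
  by apply/codeE; rewrite !mulrA mulrVK //; apply/(power_spanMs gx2)/codeE.
by exists (d ^+ (p ^ e)); rewrite -i12 -wc mulrVK.
Qed.

(** Powers of Frobenius are onto L and commute with sigma. *)
Let x1_graded : graded sigma iota2 1 x1.
Proof.
have [e i12] := iota_frob => c; have [d ->] := frob_surj e c.
by rewrite -i12 gx1 /= i12; congr (iota2 _ * _); rewrite rmorphXn.
Qed.

(* Expanding [x2 ^+ i] over the basis [x1 ^+ l * w] of the second code, left
   multiplication by [x1] leaves the code only through the top basis vector. *)
Let top_defect : exists (y : M) (eta : L -> L),
  (forall c, y * iota2 c = iota2 (eta c) * y) /\
  forall i, (i < K)%N -> exists b, C2 (x1 * x2 ^+ i - iota2 b * y).
Proof.
have [e i12] := iota_frob; have [eta wE] := w_twist.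
exists (x1 ^+ K * w), (fun c => iter K sigma (eta c)); split=> [c|i lt_i].
  by rewrite -mulrA wE mulrA (gradedX1 x1_graded) -mulrA.
have /codeE[b xb] : C2 (x2 ^+ i / w * w).
  by rewrite mulrVK //; apply: power_spanX.
have KE : K.-1.+1 = K by rewrite prednK.
have recr m (t : nat -> M) : (0 < m)%N -> \sum_(i < m) t i = \sum_(i < m.-1) t i + t m.-1.
  by case: m => // m _; rewrite big_ord_recr.
have -> : x2 ^+ i = expansion iota1 x1 K b * w by rewrite -xb mulrVK.
exists (sigma (b K.-1) ^+ (p ^ e)); rewrite -i12 !mulrA (mulx_expansion gx1).
rewrite -mulrBl; apply/codeE.
rewrite (recr _ (fun i => iota1 (sigma (b i)) * x1 ^+ i.+1) K_gt0) KE addrK.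
elim/big_rec: _ => [|l u _ Cu]; first by exists (fun=> 0); rewrite expansion0.
apply: power_spanD => //; apply/power_spanZ/power_spanX; have := ltn_ord l; lia.
Qed.

(** On the right, iota_2(c) passes x_1 x_2^i with twist sigma^(i+1) and passes y with twist eta.
    Subtracting the two forms of the defect leaves b (eta c - sigma^(i+1) c) y in the code, although
    b <> 0 and y is outside it. *)
Let twisted_defect y eta i b : (i < K)%N -> ~ C2 y ->
    (forall c, y * iota2 c = iota2 (eta c) * y) ->
    C2 (x1 * x2 ^+ i - iota2 b * y) -> ~ C2 (x1 * x2 ^+ i) ->
  forall c, eta c = iter i.+1 sigma c.
Proof.
move=> lt_i NCy yE Cb NCi c; apply/eqP; rewrite -subr_eq0; apply/negP => /negP nz.
have nz_b : b != 0.
  by apply: contra_notN NCi => /eqP b0; move: Cb; rewrite b0 rmorph0 mul0r subr0.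
case: NCy; apply: (@power_spanZI _ _ _ iota2 x2 K (b * (eta c - iter i.+1 sigma c))).
  by rewrite mulf_neq0.
have gxi : x1 * x2 ^+ i * iota2 c = iota2 (iter i.+1 sigma c) * (x1 * x2 ^+ i).
  by rewrite -(mulrA x1) (gradedX1 gx2) (mulrA x1) x1_graded (mulrA (iota2 _) x1).
have := power_spanB (power_spanZ (iter i.+1 sigma c) Cb) (power_spanMs gx2 c Cb).
rewrite mulrBr mulrBl gxi opprB addrC addrA subrK.
rewrite -(mulrA (iota2 b)) yE !mulrA -!rmorphM -mulrBl -rmorphB.
by rewrite [_ * b]mulrC -mulrBr.
Qed.

(** If both products left the code, eta would equal sigma^(i+1) and sigma^(i+2) at once, which n >=
    2 excludes. *)
Let consecutive_defect i : (i.+1 < K)%N -> C2 (x1 * x2 ^+ i) \/ C2 (x1 * x2 ^+ i.+1).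
Proof.
move=> lt_i; have [y [eta [yE defect]]] := top_defect.
have [Cy|NCy] := pselect (C2 y).
  have [b Cb] := defect _ (ltnW lt_i); left.
  by rewrite -[x1 * _](subrK (iota2 b * y)); apply: power_spanD => //; apply: power_spanZ.
have [|NC] := pselect (C2 (x1 * x2 ^+ i)); first by left.
have [|NC'] := pselect (C2 (x1 * x2 ^+ i.+1)); first by right.
have [b Cb] := defect _ (ltnW lt_i); have [b' Cb'] := defect _ lt_i.
have e1 := twisted_defect (ltnW lt_i) NCy yE Cb NC.
have e2 := twisted_defect lt_i NCy yE Cb' NC'.
have : i.+1 = i.+2 %[mod n] by apply: (iter_gal_inj sigma_gen) => c; rewrite -e1 e2.
move/eqP; rewrite eq_sym -addn1 -[X in _ == X %[mod _]]addn0 eqn_modDl.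
by rewrite mod0n modn_small.
Qed.

(** Since x_1 has degree 1 over iota_2, only exponents congruent to 1 modulo n occur in its
    expansion. *)
Let x1_coef a i : x1 = expansion iota2 x2 N a -> (i < N)%N -> a i != 0 ->
  i = 1 %[mod n].
Proof.
move=> x1a ltiN nz_ai; apply: (iter_gal_inj sigma_gen) => c.
have := x1_graded c; rewrite x1a (expansionMs gx2) expansionZ.
by move/(free_powers_inj fr2)/(_ _ ltiN); rewrite mulrC => /(mulIf nz_ai).
Qed.

Lemma code_equivalence_generators : exists e,
  [/\ forall c, iota1 c = iota2 (c ^+ (p ^ e)), graded sigma iota2 1 x1 &
   (exists b, x1 = iota2 b * x2) \/ (n = 2%N /\ exists b, x1 * x2 = iota2 b)].
Proof.
have [e i12] := iota_frob; exists e; split=> // {e i12}.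
have [a x1a] := sp2 x1.
have [a0|[d [/andP[d_ge2 ltdN] nz_d a0]]] := max_coef N a 2.
  left; exists (a 1%N); rewrite x1a (@expansion_trunc _ _ _ _ _ 2) //; last by rewrite /N; nia.
  rewrite /expansion big_ord_recl big_ord1 /= mulr1 expr1.
  have /eqP -> : a 0%N == 0; last by rewrite rmorph0 add0r.
  apply: contraT => nz0; have ltN0 : (0 < N)%N by rewrite /N; nia.
  by have := x1_coef x1a ltN0 nz0; rewrite mod0n modn_small.
have Nshift i : (K <= d + i < N)%N -> ~ C2 (x1 * x2 ^+ i).
  move=> di; rewrite x1a => /(top_coef_shift fr2 leKN di a0) ad0.
  by rewrite ad0 eqxx in nz_d.
have dN : (N <= d.+1)%N.
  rewrite leqNgt; apply/negP => lt_d1.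
  (* With i = K - d, truncated to 0 when d >= K, both d + i and d + i + 1 lie in [K, N), so x_1
     x_2^i and x_1 x_2^(i+1) both leave the code. *)
  have [] := @consecutive_defect (K - d); [lia|apply: Nshift; lia|apply: Nshift; lia].
(* The top exponent d = N - 1 is congruent to both n - 1 and 1 modulo n. *)
have n2 : n = 2%N.
  have dE : d = N.-1 by lia.
  have := x1_coef x1a ltdN nz_d; rewrite dE => /eqP.
  have -> : N.-1 = (s.-1 * n + n.-1)%N by rewrite /N; nia.
  rewrite modnMDl modn_small ?modn_small //; lia.
right; split=> //.
(* Here n = 2 and x1 has top degree N - 1, so x1 leaves the code. The product x1 x2
   has degree d' < s; d' = 2 is ruled out by cancelling the defects of 1 and of
   x2^(s-1) against each other. *)
have k1 : k = 1%N by lia.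
have KE : K = s by rewrite /K k1 muln1.
have NE : N = (s + s)%N by rewrite /N n2 muln2 addnn.
have dE : d = (s + s).-1 by lia.
have NC0 : ~ C2 (x1 * x2 ^+ 0) by apply: Nshift; lia.
have [c fc] := sp2 (x1 * x2).
have Cf : C2 (expansion iota2 x2 N c).
  have [|//|] := @consecutive_defect 0; first lia.
  by rewrite expr1 fc.
have c_hi := power_span_coef fr2 leKN Cf.
have [c0|[d' [/andP[d'_ge1 ltd'N] nz_d' c0]]] := max_coef N c 1.
  exists (c 0%N); rewrite fc (@expansion_trunc _ _ _ _ _ 1) //; last lia.
  by rewrite /expansion big_ord1 mulr1.
have ltd'K : (d' < K)%N.
  by rewrite ltnNge; apply: contra nz_d' => le; rewrite c_hi ?le.
have Nshift' i : (K <= d' + i < N)%N -> ~ C2 (x1 * x2 ^+ i.+1).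
  move=> di; rewrite exprS mulrA fc => /(top_coef_shift fr2 leKN di c0) ad0.
  by rewrite ad0 eqxx in nz_d'.
(* The product has degree 2 over iota_2, so exponent 1 cannot occur when n = 2. For d' >= 3 the
   powers s - d' + 1 and s - d' + 2 of x_2 give consecutive products of degrees s and s + 1, both
   outside the code. *)
have d'2 : d' = 2%N.
  have [//|] := eqVneq d' 2%N => d'N2; have [d'1|d'N1] := eqVneq d' 1%N.
    have : 1 = 2 %[mod n]; last by rewrite n2.
    apply: (iter_gal_inj sigma_gen) => z.
    have := congr1 ( *%R^~ (iota2 z)) fc; rewrite (expansionMs gx2) -mulrA gx2 mulrA x1_graded.
    rewrite -mulrA fc expansionZ => /(free_powers_inj fr2)/(_ _ ltd'N).
    by rewrite mulrC => /(mulfI nz_d'); rewrite d'1 /= => ->.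
  exfalso; have [] := @consecutive_defect (s - d').+1; first lia.
    by apply: Nshift'; lia.
  by apply: Nshift'; lia.
have NC1 : ~ C2 (x1 * x2 ^+ s.-1).
  have -> : s.-1 = s.-2.+1 by lia.
  by apply: Nshift'; lia.
have [y [eta [yE defect]]] := top_defect.
have lt_s1 : (s.-1 < K)%N by lia.
have [b0 Cb0] := defect _ K_gt0; have [b1 Cb1] := defect _ lt_s1.
have nz_b1 : b1 != 0.
  by apply: contra_notN NC1 => /eqP b0'; move: Cb1; rewrite b0' rmorph0 mul0r subr0.
(* This combination cancels y. *)
have : C2 (iota2 b1 * x1 - iota2 b0 * (x1 * x2 ^+ s.-1)).
  have := power_spanB (power_spanZ b1 Cb0) (power_spanZ b0 Cb1).
  rewrite !mulrBr !mulrA -!rmorphM expr0 mulr1 [b1 * b0]mulrC opprB addrA.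
  by rewrite subrK.
have -> : s.-1 = s.-2.+1 by lia.
rewrite exprS (mulrA x1) fc x1a expansionMX (@expansion_trunc _ _ _ _ _ N); last 2 first.
- by rewrite leq_addr.
- by move=> i /andP[leNi lti]; case: ltnP => // _; apply: c0; lia.
(* At exponent d = 2s - 1 only b_1 x_1 contributes: the other product has degree d' + s - 2 = s, and
   d' = 2 < s. *)
rewrite !expansionZ expansionB => /(power_span_coef fr2 leKN)/(_ d).
rewrite ltdN; have -> : (K <= d)%N by lia.
move=> /(_ isT); case: ltnP => [|_]; first lia.
rewrite c0 ?mulr0 ?subr0; last lia.
by move/eqP; rewrite mulf_eq0 (negPf nz_b1) (negPf nz_d).
Qed.

End Equivalence.

Lemma coef_comp_scaleX (R : comNzRingType) (P : {poly R}) c i :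
  (P \Po (c *: 'X))`_i = P`_i * c ^+ i.
Proof.
rewrite comp_polyE coef_sum; under eq_bigr do rewrite exprZn coefZ coefZ coefXn.
have [lti|lei] := ltnP i (size P).
  rewrite (bigD1 (Ordinal lti)) //= eqxx mulr1 big1 ?addr0 // => j.
  by rewrite -val_eqE /= eq_sym => /negPf ->; rewrite !mulr0.
rewrite nth_default // mul0r big1 // => j _.
by rewrite gtn_eqF ?mulr0 // (leq_trans _ lei).
Qed.

(** * Norms and the resulting relations between F and G *)

Section Norm.
Variables (Fq : finFieldType) (L : splittingFieldType Fq) (sigma : gal_of {:L}).
Let n := \dim {:L}.

(** For m = n and a generator sigma this is the norm from L to Fq. *)
Definition partial_norm m (b : L) := \prod_(i < m) iter i sigma b.

Lemma partial_normS m b : partial_norm m.+1 b = b * sigma (partial_norm m b).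
Proof.
by rewrite /partial_norm big_ord_recl rmorph_prod.
Qed.

Lemma partial_norm_neq0 m b : b != 0 -> partial_norm m b != 0.
Proof.
by move=> nz; apply/prodf_neq0 => i _; rewrite iter_galE fmorph_eq0.
Qed.

(** The product of n + 1 conjugates is both b sigma(N) and N b, so N is fixed by sigma. *)
Lemma norm_scalar (sigma_gen : generator 'Gal({:L} / 1)%g sigma) b :
  exists l, partial_norm n b = l%:A.
Proof.
apply: (gal_fixed_scalar sigma_gen); have [->|nz_b] := eqVneq b 0.
  have := dim_gt0 L; rewrite -/n; case: (n) => // m _.
  by rewrite partial_normS mul0r rmorph0.
apply: (mulfI nz_b); rewrite -partial_normS /partial_norm big_ord_recr /=.
by rewrite iter_gal_dim mulrC.
Qed.

Variables (M : pzRingType) (iota : {rmorphism L -> M}) (x : M).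
Hypothesis gx : graded sigma iota 1 x.

Lemma exprMs m b : (iota b * x) ^+ m = iota (partial_norm m b) * x ^+ m.
Proof.
elim: m => [|m IHm]; first by rewrite /partial_norm big_ord0 rmorph1 mul1r.
rewrite exprS IHm partial_normS -mulrA (mulrA x) gx /= rmorphM exprS.
by rewrite !mulrA.
Qed.

End Norm.

Section Relations.
Variables (Fq : finFieldType) (L : splittingFieldType Fq) (sigma : gal_of {:L}).
Hypothesis sigma_gen : generator 'Gal({:L} / 1)%g sigma.
Let n := \dim {:L}.

Section Unique.
Variables (M : pzRingType) (iota : {rmorphism L -> M}) (x : M) (s : nat).

Variable G : {poly Fq}.
Hypotheses (G_monic : G \is monic) (G_deg : size G = s.+1).
Hypotheses (fr : free_powers iota x (s * n)%N) (relG : poly_relation iota x G).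

(** Subtracting h_s times G(x^n) = 0 leaves a relation of degree below s in x^n, and freeness of the
    powers makes it trivial. *)
Lemma relation_unique (h : nat -> Fq) :
    \sum_(i < s.+1) iota (h i)%:A * (x ^+ n) ^+ i = 0 ->
  forall i, (i <= s)%N -> h i = h s * G`_i.
Proof.
have Gs : G`_s = 1 by move: G_monic; rewrite monicE /lead_coef G_deg => /eqP.
move=> relh i; rewrite leq_eqVlt => /predU1P[->|lt_is]; first by rewrite Gs mulr1.
pose d j := h j - h s * G`_j.
have : \sum_(j < s) iota (d j)%:A * (x ^+ n) ^+ j = 0.
  have := congr1 ( *%R (iota (h s)%:A)) relG; rewrite /poly_relation G_deg mulr0 mulr_sumr.
  move/(congr2 (fun u v => u - v) relh); rewrite subr0 -sumrB big_ord_recr /=.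
  rewrite Gs scale1r rmorph1 mul1r subrr addr0 => rel0; rewrite -[RHS]rel0.
  apply: eq_bigr => j _; rewrite mulrA -mulrBl -rmorphM -rmorphB.
  by rewrite /d scalerBl -scalerAl mul1r scalerA.
rewrite relation_expansion => /fr/(_ (i * n)%N).
rewrite ltn_pmul2r ?dim_gt0 // => /(_ lt_is).
rewrite mulnK ?dim_gt0 // modnMl mulr1n => /eqP.
by rewrite scaler_eq0 oner_eq0 orbF subr_eq0 => /eqP.
Qed.

End Unique.

Variables (M : nzRingType) (iota1 iota2 : {rmorphism L -> M}) (x1 x2 : M).
Variables (s p e : nat) (F G : {poly Fq}).
Hypotheses (s_gt0 : (0 < s)%N) (F_monic : F \is monic) (F_deg : size F = s.+1).
Hypotheses (F0 : F`_0 != 0) (G0 : G`_0 != 0).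
Hypotheses (G_monic : G \is monic) (G_deg : size G = s.+1).
Hypotheses (gx1 : graded sigma iota2 1 x1) (gx2 : graded sigma iota2 1 x2).
Hypothesis fr2 : free_powers iota2 x2 (s * n)%N.
Hypotheses (relF : poly_relation iota1 x1 F) (relG : poly_relation iota2 x2 G).
Hypothesis iota12 : forall c, iota1 c = iota2 (c ^+ (p ^ e)).

Let relF' : \sum_(i < s.+1) iota2 (F`_i ^+ (p ^ e))%:A * (x1 ^+ n) ^+ i = 0.
Proof.
rewrite -[RHS]relF F_deg; apply: eq_bigr => i _.
by rewrite iota12 exprZn expr1n.
Qed.

Let Fs1 : F`_s = 1.
Proof. by move: F_monic; rewrite monicE /lead_coef F_deg => /eqP. Qed.

Let F0e : F`_0 ^+ (p ^ e) != 0. Proof. exact: expf_neq0. Qed.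

(** Here x_1^n = l x_2^n, where l is the norm of b; substitution turns the twisted relation of F
    into one for x_2^n, which must be a multiple of that of G. *)
Lemma scaled_relation b : x1 = iota2 b * x2 -> exists2 l, l != 0 &
  forall i, (i <= s)%N -> F`_i ^+ (p ^ e) * l ^+ i = l ^+ s * G`_i.
Proof.
move=> x1E; have [l Nb] := norm_scalar sigma_gen b.
have x1n : x1 ^+ n = iota2 l%:A * x2 ^+ n by rewrite x1E (exprMs gx2) Nb.
pose h i := F`_i ^+ (p ^ e) * l ^+ i.
have cl : GRing.comm (iota2 l%:A) (x2 ^+ n).
  apply: commrX; rewrite /GRing.comm gx2 /=; congr (iota2 _ * _).
  by rewrite gal_scalar.
have /(relation_unique G_monic G_deg fr2 relG) hE : 
    \sum_(i < s.+1) iota2 (h i)%:A * (x2 ^+ n) ^+ i = 0.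
  rewrite -[RHS]relF'; apply: eq_bigr => i _; rewrite x1n exprMn_comm //.
  rewrite mulrA -rmorphXn -rmorphM; congr (iota2 _ * _).
  by rewrite exprZn expr1n -scalerAl mul1r scalerA.
have Fs : h s = l ^+ s by rewrite /h Fs1 expr1n mul1r.
exists l => [|i le_i]; last by rewrite -Fs -hE.
apply: contraNneq F0e => l0; have := hE 0%N isT.
by rewrite Fs l0 expr0n gtn_eqF //= mul0r /h expr0 mulr1 => ->.
Qed.

(** For n = 2, x_1^n x_2^n = sigma(b) b = l, the norm of b. Multiplying the relation of F by
    x_2^(ns) therefore reverses its coefficients. *)
Lemma reciprocal_relation b : n = 2%N -> x1 * x2 = iota2 b -> exists l, 
  [/\ l != 0, l ^+ s = F`_0 ^+ (p ^ e) * G`_0 &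
      forall i, (i <= s)%N -> F`_i ^+ (p ^ e) * l ^+ i = F`_0 ^+ (p ^ e) * G`_(s - i)].
Proof.
move=> n2 xb; have [l Nb] := norm_scalar sigma_gen b.
have xl : x1 ^+ n * x2 ^+ n = iota2 l%:A.
  rewrite -Nb -/n n2 /partial_norm big_ord_recl big_ord1 /= exprS expr1 exprS expr1.
  by rewrite -mulrA (mulrA x1 x2) xb mulrA gx1 -mulrA xb -rmorphM mulrC.
have cl : GRing.comm (x1 ^+ n) (iota2 l%:A).
  apply/commr_sym/commrX; rewrite /GRing.comm gx1 /=; congr (iota2 _ * _).
  by rewrite gal_scalar.
have xli i j : (x1 ^+ n) ^+ i * (x2 ^+ n) ^+ (i + j) = iota2 (l ^+ i)%:A * (x2 ^+ n) ^+ j.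
  elim: i => [|i IHi]; first by rewrite !expr0 scale1r rmorph1.
  rewrite exprSr addSn exprS -!mulrA (mulrA (x1 ^+ n) (x2 ^+ n)) xl mulrA.
  rewrite (commr_sym (commrX i (commr_sym cl))) -mulrA IHi mulrA -rmorphM.
  by rewrite -scalerAl mul1r scalerA -exprS.
pose h j := F`_(s - j) ^+ (p ^ e) * l ^+ (s - j).
have /(relation_unique G_monic G_deg fr2 relG) hE : 
    \sum_(i < s.+1) iota2 (h i)%:A * (x2 ^+ n) ^+ i = 0.
  have := congr1 ( *%R^~ ((x2 ^+ n) ^+ s)) relF'; rewrite mul0r mulr_suml => rel0.
  rewrite -[RHS]rel0 (reindex_inj rev_ord_inj); apply: eq_bigr => i _ /=.
  have le_is : (i <= s)%N by rewrite -ltnS.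
  have := xli i (s - i)%N; rewrite subnKC // => xE.
  rewrite subSS -mulrA xE mulrA -rmorphM /h subKn //.
  by rewrite -scalerAl mul1r scalerA.
have hE' i : (i <= s)%N -> F`_i ^+ (p ^ e) * l ^+ i = F`_0 ^+ (p ^ e) * G`_(s - i).
  move=> le_i; have := hE (s - i)%N (leq_subr _ _).
  by rewrite /h subnn expr0 mulr1 subKn.
have ls : l ^+ s = F`_0 ^+ (p ^ e) * G`_0.
  by have := hE' s (leqnn _); rewrite Fs1 expr1n mul1r subnn.
exists l; split=> //; apply: contraTneq isT => l0.
have : F`_0 ^+ (p ^ e) * G`_0 != 0 by rewrite mulf_neq0.
by rewrite -ls l0 expr0n gtn_eqF // eqxx.
Qed.

End Relations.

Lemma card_finvect (K : finFieldType) (V : vectType K) :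
  #|finvect_type V| = (#|K| ^ \dim {:V})%N.
Proof.
have := @card_vspace K _ (Vector.class (finvect_type V : vectType K)) fullv.
by rewrite card_vspacef => ->.
Qed.

(** * Roots of F in the field with q^s elements *)

Section RootInFiniteField.
Variables (K : finFieldType) (F : {poly K}) (s : nat).
Hypotheses (F_irr : irreducible_poly F) (F_deg : size F = s.+1).

Lemma irreducible_dvdp_root (E : fieldType) (j : {rmorphism K -> E}) (e : E) P :
  root (map_poly j F) e -> root (map_poly j P) e -> F %| P.
Proof.
move=> Fe Pe; case: F_irr => sF /(_ (gcdp F P)) irr.
have [s1|s1] := eqVneq (size (gcdp F P)) 1%N.
  have : coprimep (map_poly j F) (map_poly j P) by rewrite coprimep_map /coprimep s1.
  by move/coprimep_root/(_ Fe); rewrite (eqP Pe) eqxx.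
by have := irr s1 (dvdp_gcdl _ _) => /eqp_dvdl <-; apply: dvdp_gcdr.
Qed.

Variables (E : finFieldType) (j : {rmorphism K -> E}).
Hypothesis card_E : #|E| = (#|K| ^ s)%N.

(** A root of F in the field it generates, which has as many elements as E, satisfies z^#|E| = z. So
    F divides X^#|E| - X, which splits over E. *)
Lemma irreducible_root_finField : exists e, root (map_poly j F) e.
Proof.
have [L0 dimL0 [z Fz _]] := irredp_FAdjoin F_irr.
pose P : {poly K} := 'X^(#|E|) - 'X.
have FP : F %| P.
  apply: (@irreducible_dvdp_root L0 (in_alg L0) z) => //.
  rewrite rmorphB /= map_polyXn map_polyX rootE !hornerE.
  suffices -> : z ^+ #|E| = z by rewrite subrr.
  have cardL0 : #|finvect_type L0| = #|E|.
    by rewrite card_E card_finvect dimL0 F_deg.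
  by rewrite -cardL0; apply: (@expf_card (finvect_type L0)).
have : map_poly j F %| \prod_(x : E) ('X - x%:P).
  rewrite -finField_genPoly.
  have -> : 'X^#|E| - 'X = map_poly j P by rewrite rmorphB /= map_polyXn map_polyX.
  by rewrite dvdp_map.
rewrite -big_enum /= => /dvdp_prod_XsubC[m].
case Dm: (mask m (enum E)) => [|e r] eqF.
  move/eqp_size: eqF; rewrite big_nil size_poly1 size_map_poly F_deg => -[s0].
  by case: F_irr; rewrite F_deg s0.
exists e; rewrite (eqp_root eqF) big_cons rootM root_XsubC eqxx.
by [].
Qed.

(** A relation is a polynomial of degree below s vanishing at e, hence divisible by F. *)
Lemma powers_free (e : E) (h : nat -> K) : root (map_poly j F) e ->
  \sum_(t < s) j (h t) * e ^+ t = 0 -> forall t, (t < s)%N -> h t = 0.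
Proof.
move=> Fe sum0 t ltt; pose P := \poly_(t < s) h t.
have FP : F %| P.
  apply: (irreducible_dvdp_root Fe); rewrite rootE -[X in _ == X]sum0.
  rewrite /P poly_def rmorph_sum horner_sum; apply/eqP/eq_bigr => i _ /=.
  by rewrite map_polyZ map_polyXn !hornerE.
have : P`_t = 0.
  suffices -> : P = 0 by rewrite coef0.
  apply: contraTeq FP => nzP; rewrite gtNdvdp // F_deg ltnS size_poly //.
by rewrite coef_poly ltt.
Qed.

End RootInFiniteField.

(** * Splitting R_F *)

Section MatrixPresentation.
Variables (Fq : finFieldType) (L : splittingFieldType Fq) (sigma : gal_of {:L}).
Hypothesis sigma_gen : generator 'Gal({:L} / 1)%g sigma.
Variables (n' : nat).
Let n := n'.+1.
Hypothesis dim_L : \dim {:L} = n.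

(** The case E = Fq of the norm theorem: there the centralizer of L is L itself, so y = b S with S
    the shift, and y^n is the norm of b. *)
Lemma norm_surj (l : Fq) : l != 0 -> exists b : L, partial_norm sigma n b = l%:A.
Proof.
pose j : {rmorphism Fq -> Fq} := idfun; move=> nz_l.
have [y [gy yn]] := @cyc_norm_surj _ _ _ sigma_gen _ dim_L Fq j l nz_l.
pose m := (cyc_mul dim_L j : {rmorphism L -> 'M[Fq]_n}).
pose S := cyc_shift sigma dim_L j.
have gyS : graded sigma m 0 (y * S ^+ n.-1).
  apply: (@cyc_graded0_mod _ _ _ sigma_gen _ dim_L _ _ 1); rewrite mul1n.
  apply: gradedM => //; have := gradedX n.-1 (cyc_shift_graded sigma dim_L j).
  by rewrite muln1.
have [b rb] := cyc_coord_surj dim_L (cyc_row dim_L j 1 *m (y * S ^+ n.-1)).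
have yE : y = m b * S.
  have <- : y * S ^+ n.-1 = m b.
    apply: graded0_row1_inj gyS (graded_scalar _ _ _) _.
    rewrite rb /= cyc_rowM mul1r; apply/rowP => i.
    by rewrite !mxE.
  by rewrite -mulrA -exprSr cyc_shiftXn // mulr1.
exists b; apply: (fmorph_inj m).
rewrite [RHS]cyc_mul_scalar -[RHS]yn yE (exprMs (cyc_shift_graded sigma dim_L j)).
by rewrite cyc_shiftXn // mulr1.
Qed.

Variables (E : finFieldType) (j : {rmorphism Fq -> E}) (s : nat) (F : {poly Fq}).
Hypothesis card_E : #|E| = (#|Fq| ^ s)%N.
Hypotheses (F_monic : F \is monic) (F_deg : size F = s.+1).
Let m := (cyc_mul dim_L j : {rmorphism L -> 'M[E]_n}).

(** Take y of degree 1 with y^n = e, a root of F in E. The grading separates exponents by their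
    residue modulo n; within one residue, freeness is that of 1, e, ..., e^(s-1) over Fq. *)
Lemma matrix_presentation : irreducible_poly F -> F`_0 != 0 -> exists y : 'M[E]_n,
  [/\ y \is a GRing.unit, graded sigma m 1 y, poly_relation m y F &
      free_powers m y (s * n)%N].
Proof.
move=> F_irr F0; have [e Fe] := irreducible_root_finField F_irr F_deg j card_E.
have nz_e : e != 0.
  apply: contraNneq F0 => e0; move: Fe; rewrite rootE e0 horner_coef0 coef_map.
  by rewrite fmorph_eq0.
have [y [gy yn]] := @cyc_norm_surj _ _ _ sigma_gen _ dim_L E j e nz_e.
exists y; split=> //.
- rewrite -(unitrX_pos _ (ltn0Sn n')) yn -[_ \is a _]/(_ \in unitmx) unitmxE.
  by rewrite det_scalar unitfE expf_neq0.
- rewrite /poly_relation dim_L -/n yn.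
  have /eqP Fe0 := Fe; rewrite -[RHS](raddf0 (@scalar_mx E n)) -Fe0 horner_poly raddf_sum.
  apply: eq_bigr => i _; rewrite [m _]cyc_mul_scalar /= scalar_mxM -rmorphXn.
  by [].
move=> a; have aE := big_ord_mul s n (fun i => m (a i) * y ^+ i).
rewrite /expansion [in LHS]aE exchange_big /= => sum0.
pose t r := \sum_(u < s) m (a (u * n + r)%N) * y ^+ (u * n + r).
have t0 r : (r < n)%N -> t r = 0.
  move=> ltr; have := @graded_independence _ _ _ sigma_gen _ m t.
  rewrite dim_L; apply=> // {ltr}r c ltr.
  apply: graded_sum => u _; rewrite -[r]add0n; apply: gradedM; first exact: graded_scalar.
  apply: (@eq_graded _ _ _ _ _ (u * n + r)%N); rewrite ?dim_L ?modnMDl //.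
  exact: gradedX1.
move=> i lt_i; pose r := (i %% n)%N; pose u := (i %/ n)%N.
have ltr : (r < n)%N by rewrite ltn_mod.
have ltu : (u < s)%N by rewrite ltn_divLR.
suffices : cyc_coord dim_L (a i) = 0.
  move=> c0; apply: (@cyc_row0 _ _ _ dim_L _ j); by rewrite /cyc_row c0 map_mx0.
apply/rowP => c; rewrite [RHS]mxE.
pose h u := cyc_coord dim_L (a (u * n + r)%N) 0 c.
have {1}-> : i = (u * n + r)%N by apply: divn_eq.
apply: (@powers_free _ F s F_irr F_deg E j e h Fe) ltu.
(* The factor y^(n-r) completes y^(vn+r) to the scalar e^(v+1), so an entry of the row of 1 gives a
   relation among powers of e, up to one spare factor e. *)
have := congr1 (fun A : 'M[E]_n => (cyc_row dim_L j 1 *m (A * y ^+ (n - r))) 0 c) (t0 r ltr).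
rewrite /t mul0r mulmx0 [RHS]mxE mulr_suml mulmx_sumr summxE.
have tE v : (cyc_row dim_L j 1 *m (m (a (v * n + r)%N) * y ^+ (v * n + r) * y ^+ (n - r))) 0 c
     = j (h v) * e ^+ v * e.
  rewrite -mulrA -exprD -addnA subnKC ?(ltnW ltr) // -mulSnr (mulnC v.+1) exprM yn.
  rewrite -rmorphXn /= -[_ * _ :> 'M_n]/(m _ *m (e ^+ v.+1)%:M) mul_mx_scalar -scalemxAr.
  by rewrite cyc_rowM mul1r /h !mxE exprSr mulrC mulrA.
under eq_bigr do rewrite tE.
by rewrite -mulr_suml => /eqP; rewrite mulf_eq0 (negPf nz_e) orbF => /eqP.
Qed.

(** Both M_n(E) and the set of coefficient families have q^(s n^2) elements, so the free powers also
    span. *)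
Lemma RF_iso (iota : {rmorphism L -> 'M[E]_n}) (x : 'M[E]_n) :
    graded sigma iota 1 x -> poly_relation iota x F ->
    free_powers iota x (s * n)%N -> 
  exists phi : {rmorphism RF sigma F -> 'M[E]_n},
  [/\ bijective phi, forall c, phi (RFscalar sigma F c) = iota c &
      phi (RFx sigma F) = x].
Proof.
move=> gx rel fr; have [phi [phiC phiX]] := RF_lift gx rel.
exists phi; split=> //.
have phiE a : phi (expansion (RFscalar sigma F : {rmorphism _ -> _}) (RFx sigma F) (s * n)%N a)
    = expansion iota x (s * n)%N a.
  by rewrite (rmorph_expansion _ phiC) phiX.
pose ext (f : {ffun 'I_(s * n)%N -> finvect_type L}) (i : nat) : L :=
  if insub i is Some i' then f i' else 0.
have extE f (i : 'I_(s * n)%N) : ext f i = f i by rewrite /ext valK.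
pose g f : 'M[E]_n := expansion iota x (s * n)%N (ext f).
have g_inj : injective g.
  move=> f1 f2 /(free_powers_inj fr) e; apply/ffunP => i.
  by rewrite -!extE; apply: e.
have card_eq : #|{: 'M[E]_n}| = #|{ffun 'I_(s * n)%N -> finvect_type L}|.
  rewrite card_mx card_ffun card_ord card_finvect dim_L card_E -!expnM.
  by congr (_ ^ _)%N; rewrite !mulnA [(n * s)%N]mulnC.
have [g' _ gK] := inj_card_bij g_inj (eq_leq card_eq).
pose psi y := expansion (RFscalar sigma F : {rmorphism _ -> _}) (RFx sigma F)
  (s * n)%N (ext (g' y)).
exists psi => u; last by rewrite /psi phiE; apply: gK.
have [a ua] := RF_spanned F_monic F_deg u; rewrite dim_L in ua.
rewrite {2}ua /psi; apply: eq_expansion => i lti.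
apply: (free_powers_inj fr) lti; rewrite -(phiE a) -ua; apply: gK.
Qed.

End MatrixPresentation.

(** * Constructing equivalences *)

Section ChangeOfGenerator.
Variables (Fq : finFieldType) (L : splittingFieldType Fq) (sigma : gal_of {:L}).
Variables (M : unitRingType) (iota : {rmorphism L -> M}) (x : M).
Let n := \dim {:L}.
Hypothesis gx : graded sigma iota 1 x.

Lemma scalar_comm (l : Fq) m : GRing.comm (iota l%:A) (x ^+ m).
Proof.
by apply: commrX; rewrite /GRing.comm gx /=; congr (iota _ * _); rewrite gal_scalar.
Qed.

Section Scaling.
Variable b : L.
Hypothesis nz_b : b != 0.
Let x2 := iota b * x.

Lemma scaled_graded : graded sigma iota 1 x2.
Proof. by rewrite -[1%N]add0n; apply: gradedM => //; apply: graded_scalar. Qed.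

Lemma scaled_expansion K a : expansion iota x2 K a =
  expansion iota x K (fun i => a i * partial_norm sigma i b).
Proof.
by apply: eq_bigr => i _; rewrite (exprMs gx) rmorphM mulrA.
Qed.

Lemma scaled_free N : free_powers iota x N -> free_powers iota x2 N.
Proof.
move=> fr a; rewrite scaled_expansion => /fr a0 i /a0 /eqP.
by rewrite mulf_eq0 (negPf (partial_norm_neq0 sigma i nz_b)) orbF => /eqP.
Qed.

Lemma scaled_power_span K u : power_span iota x2 K u <-> power_span iota x K u.
Proof.
split=> -[a ->]; first by rewrite scaled_expansion; eexists.
exists (fun i => a i / partial_norm sigma i b); rewrite scaled_expansion.
by apply: eq_expansion => i _; rewrite divfK // partial_norm_neq0.
Qed.

(** As b has norm l^-1, the n-th power of the new generator is l^-1 x^n, and the relation [h]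
    divided by l^s becomes that of G. *)
Lemma scaled_presentation s (h : nat -> Fq) (G : {poly Fq}) l : size G = s.+1 ->
    \sum_(i < s.+1) iota (h i)%:A * (x ^+ n) ^+ i = 0 ->
    l != 0 -> partial_norm sigma n b = l^-1%:A ->
  (forall i, (i <= s)%N -> h i * l ^+ i = l ^+ s * G`_i) -> poly_relation iota x2 G.
Proof.
move=> G_deg relh nz_l Nb hG; have nz_ls : l ^+ s != 0 by rewrite expf_neq0.
have /(congr1 ( *%R (iota (l ^- s)%:A))) := relh; rewrite mulr0 mulr_sumr => rel0.
rewrite /poly_relation -[RHS]rel0 G_deg; apply: eq_bigr => i _.
rewrite (exprMs gx) Nb exprMn_comm; last exact: scalar_comm.
rewrite !mulrA -rmorphXn -!rmorphM exprZn expr1n -!scalerAl !mul1r !scalerA.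
congr (iota _%:A * _); apply: (mulfI nz_ls).
rewrite mulrA -hG; last exact: ltn_ord i.
by rewrite exprVn mulfK ?expf_neq0 // mulVKf.
Qed.

End Scaling.

Section Reciprocal.
Hypotheses (x_unit : x \is a GRing.unit) (n2 : n = 2%N).
Variable b : L.
Hypothesis nz_b : b != 0.
Let x2 := iota b * x^-1.

(** The inverse has degree -1, which is 1 modulo n = 2. *)
Lemma inverse_graded : graded sigma iota 1 x^-1.
Proof.
move=> c; apply: (canLR (mulKr x_unit)); rewrite mulrA gx /=.
have -> : sigma (sigma c) = c by have := iter_gal_dim sigma c; rewrite -/n n2.
by rewrite mulrK.
Qed.

Lemma reciprocal_graded : graded sigma iota 1 x2.
Proof.
rewrite -[1%N]add0n; apply: gradedM; [exact: graded_scalar | exact: inverse_graded].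
Qed.

(** Multiplication by x^(K-1) sends the powers of x^-1 below K to those of x below K in reverse
    order; so the two codes differ by a right factor. *)
Lemma reciprocal_expansion K a : (0 < K)%N -> expansion iota x2 K a * x ^+ K.-1 =
  expansion iota x K
    (fun i => a (K.-1 - i)%N * partial_norm sigma (K.-1 - i) b).
Proof.
case: K => // K _; rewrite /expansion (reindex_inj rev_ord_inj) mulr_suml.
apply: eq_bigr => i _ /=; rewrite subSS (exprMs inverse_graded) -!mulrA.
have le_i : (i <= K)%N by rewrite -ltnS.
rewrite rmorphM -mulrA; do 2!congr (_ * _).
have -> : x ^+ K = x ^+ (K - i) * x ^+ i by rewrite -exprD subnK.
by rewrite mulrA exprVn mulVr ?mul1r ?unitrX.
Qed.

Lemma reciprocal_free N : (0 < N)%N -> free_powers iota x N -> free_powers iota x2 N.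
Proof.
move=> N_gt0 fr a /(congr1 ( *%R^~ (x ^+ N.-1))).
rewrite mul0r reciprocal_expansion // => /fr a0 i lti.
have := a0 (N.-1 - i)%N; rewrite subKn; last by lia.
have -> : (N.-1 - i < N)%N by lia.
move=> /(_ isT)/eqP.
by rewrite mulf_eq0 (negPf (partial_norm_neq0 sigma i nz_b)) orbF => /eqP.
Qed.

Lemma reciprocal_power_span K u : (0 < K)%N ->
  power_span iota x2 K u <-> power_span iota x K (u * x ^+ K.-1).
Proof.
move=> K_gt0; split=> [[a ->]|[a ua]].
  by rewrite reciprocal_expansion //; eexists.
exists (fun i => a (K.-1 - i)%N / partial_norm sigma i b).
apply: (mulIr (unitrX K.-1 x_unit)); rewrite ua reciprocal_expansion //.
apply: eq_expansion => i lti; rewrite divfK ?partial_norm_neq0 // subKn //; lia.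
Qed.

(** The new generator has n-th power l x^(-n); multiplying G at it by x^(ns) reverses the
    coefficients and gives l^s / c times the relation [h]. *)
Lemma reciprocal_presentation s (h : nat -> Fq) (G : {poly Fq}) l c :
    size G = s.+1 -> \sum_(i < s.+1) iota (h i)%:A * (x ^+ n) ^+ i = 0 ->
    c != 0 -> partial_norm sigma n b = l%:A ->
    (forall i, (i <= s)%N -> h i * l ^+ i = c * G`_(s - i)) ->
  poly_relation iota x2 G.
Proof.
move=> G_deg relh nz_c Nb hG.
have /(congr1 ( *%R (iota (l ^+ s / c)%:A))) := relh; rewrite mulr0 mulr_sumr => rel0.
apply: (mulIr (unitrX s (unitrX n x_unit))); rewrite mul0r -[RHS]rel0.
rewrite /poly_relation G_deg mulr_suml (reindex_inj rev_ord_inj).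
apply: eq_bigr => i _ /=; rewrite subSS (exprMs inverse_graded) Nb.
have le_i : (i <= s)%N by rewrite -ltnS.
rewrite exprMn_comm; last first.
  apply: commrX; rewrite /GRing.comm inverse_graded /=; congr (iota _ * _).
  by rewrite gal_scalar.
have -> : (x ^+ n) ^+ s = (x ^+ n) ^+ (s - i) * (x ^+ n) ^+ i by rewrite -exprD subnK.
rewrite -!mulrA [x^-1 ^+ n ^+ _ * _]mulrA !exprVn mulVr ?unitrX // mul1r.
rewrite !mulrA -rmorphXn -!rmorphM exprZn expr1n -!scalerAl !mul1r !scalerA.
congr (iota _%:A * _); apply: (mulfI nz_c); rewrite mulrA -hG //.
by rewrite -mulrA -exprD subnKC // mulrA [c * _]mulrC divfK // mulrC.
Qed.

End Reciprocal.
End ChangeOfGenerator.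

Lemma frob_inverse (K : finFieldType) p (pcharKp : p \in [pchar K]) e :
  exists e', forall c : K, (c ^+ (p ^ e)) ^+ (p ^ e') = c.
Proof.
have [m m_gt0 cardK] := card_finField_pchar pcharKp.
(* The exponents add up to em, and p^(em) = #|K|^e acts trivially on K. *)
exists (e * m.-1)%N => c; rewrite -exprM -expnD -[X in (X + _)%N]muln1 -mulnDr.
rewrite add1n prednK // mulnC expnM -cardK; elim: e => [|e IHe]; first by rewrite expr1.
by rewrite expnSr exprM IHe expf_card.
Qed.

Lemma prime_field_aut_frob (K : finFieldType) p (pcharKp : p \in [pchar K]) e :
  prime_field_aut (frob pcharKp e : {rmorphism K -> K}).
Proof.
split; last by move=> m; apply: (rmorph_nat (frob pcharKp e : {rmorphism K -> K})).
exact: (injF_bij (fmorph_inj (frob pcharKp e : {rmorphism K -> K}))).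
Qed.

(** * Twisting by Frobenius and transport of codes *)

Section Twist.
Variables (Fq : finFieldType) (L : splittingFieldType Fq) (sigma : gal_of {:L}).
Variables (p : nat) (pcharLp : p \in [pchar L]) (e e' : nat).
Hypothesis frobK : forall c : L, (c ^+ (p ^ e)) ^+ (p ^ e') = c.
Variables (M : pzRingType) (iota : {rmorphism L -> M}) (x : M).

(** Precomposing with the inverse Frobenius keeps x and the code, while the coefficients of F in its
    relation become their p^e-th powers. *)
Definition twist : {rmorphism L -> M} := iota \o frob pcharLp e'.

Lemma twistE c : twist c = iota (c ^+ (p ^ e')).
Proof. by []. Qed.

Lemma twistK c : iota c = twist (c ^+ (p ^ e)).
Proof. by rewrite twistE frobK. Qed.

Lemma twist_graded i : graded sigma iota i x -> graded sigma twist i x.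
Proof.
move=> gx c; rewrite !twistE gx; congr (iota _ * _).
by rewrite !iter_galE rmorphXn.
Qed.

Lemma twist_free N : free_powers iota x N -> free_powers twist x N.
Proof.
move=> fr a a0 i lti; apply/eqP; rewrite -(fmorph_eq0 (frob pcharLp e')).
by apply/eqP/(fr (fun i => frob pcharLp e' (a i)) _ i lti); rewrite -[RHS]a0.
Qed.

Lemma twist_power_span K u : power_span iota x K u <-> power_span twist x K u.
Proof.
split=> -[a ->].
  by exists (fun i => a i ^+ (p ^ e)); apply: eq_bigr => i _; rewrite -twistK.
by exists (fun i => a i ^+ (p ^ e')).
Qed.

Lemma twist_relation (F : {poly Fq}) s : size F = s.+1 -> poly_relation iota x F ->
  \sum_(i < s.+1) twist (F`_i ^+ (p ^ e))%:A * (x ^+ \dim {:L}) ^+ i = 0.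
Proof.
move=> F_deg rel; rewrite -[RHS]rel F_deg; apply: eq_bigr => i _.
by rewrite twistK exprZn expr1n.
Qed.

End Twist.

Section CodeImage.
Variables (Fq : finFieldType) (L : splittingFieldType Fq) (sigma : gal_of {:L}).
Variables (F : {poly Fq}) (M : pzRingType) (phi : {rmorphism RF sigma F -> M}).
Variables (iota : {rmorphism L -> M}) (x : M).
Hypotheses (phiC : forall c, phi (RFscalar sigma F c) = iota c).
Hypotheses (phiX : phi (RFx sigma F) = x).

Lemma skew_code_power_span s k y :
  (exists2 u, skew_code sigma s k F u & phi u = y) <-> power_span iota x (s * k)%N y.
Proof.
split=> [[_ [alpha ->] <-]|[a ->]].
  pose a i := if insub i is Some i' then alpha i' else 0.
  have aE (i : 'I_(s * k)) : alpha i = a i by rewrite /a valK.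
  exists a; rewrite -phiX -(rmorph_expansion _ phiC) -RFclass_expansion.
  by congr (phi (RFclass _ _ _)); apply: eq_bigr => i _; rewrite aE.
exists (RFclass sigma F (\sum_(i < s * k) skewC sigma (a i) * skewX sigma ^+ i)).
  by exists a.
by rewrite RFclass_expansion (rmorph_expansion _ phiC) phiX.
Qed.

End CodeImage.

Section Conjugation.
Variables (M : unitRingType) (u : M).
Hypothesis u_unit : u \is a GRing.unit.

Definition conjugation of u \is a GRing.unit := fun y : M => u * y * u^-1.

Lemma conjugation_is_zmod : zmod_morphism (conjugation u_unit).
Proof. by move=> y z; rewrite /conjugation mulrBr mulrBl. Qed.
Lemma conjugation_is_monoid : monoid_morphism (conjugation u_unit).
Proof.
split=> [|y z]; rewrite /conjugation; first by rewrite mulr1 mulrV.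
by rewrite !mulrA mulrVK.
Qed.
HB.instance Definition _ :=
  GRing.isZmodMorphism.Build M M (conjugation u_unit) conjugation_is_zmod.
HB.instance Definition _ :=
  GRing.isMonoidMorphism.Build M M (conjugation u_unit) conjugation_is_monoid.

Lemma conjugation_inj : injective (conjugation u_unit).
Proof.
have uV_unit : u^-1 \is a GRing.unit by rewrite unitrV.
by move=> y z /(mulIr uV_unit)/(mulrI u_unit).
Qed.

End Conjugation.

(** * The two implications *)

Section Main.
Variables (p n' s k : nat) (Fq : finFieldType) (L : splittingFieldType Fq).
Variables (E : fieldExtType Fq) (sigma : gal_of {:L}) (F G : {poly Fq}).
Let n := n'.+1.
Hypotheses (pcharFqp : p \in [pchar Fq]).
Hypotheses (n_ge2 : (2 <= n)%N) (s_ge2 : (2 <= s)%N).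
Hypotheses (k_gt0 : (0 < k)%N) (ltkn : (k < n)%N).
Hypotheses (dim_L : \dim {:L} = n) (dim_E : \dim {:E} = s).
Hypothesis sigma_gen : generator 'Gal({:L} / 1)%g sigma.
Hypotheses (F_monic : F \is monic) (F_irr : irreducible_poly F) (F_deg : size F = s.+1).
Hypotheses (G_monic : G \is monic) (G_irr : irreducible_poly G) (G_deg : size G = s.+1).

Lemma irreducible_coef0 (P : {poly Fq}) : irreducible_poly P -> size P = s.+1 -> P`_0 != 0.
Proof.
move=> P_irr P_deg; apply/negP => /eqP P0.
have : 'X %| P by rewrite -['X]subr0 -polyC0 dvdp_XsubCl rootE horner_coef0 P0.
case: P_irr => _ irr /(irr 'X); rewrite size_polyX => /(_ isT)/eqp_size.
by rewrite size_polyX P_deg; lia.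
Qed.

Let pcharLp : p \in [pchar L]. Proof. by rewrite (fmorph_pchar (in_alg L)). Qed.
Let pcharEp : p \in [pchar E]. Proof. by rewrite (fmorph_pchar (in_alg E)). Qed.

Definition poly_equivalent : Prop := exists (tau : {rmorphism Fq -> Fq}) (lam : Fq),
    [/\ prime_field_aut tau, lam != 0
      & map_poly tau F = lam ^+ s *: (G \Po (lam^-1 *: 'X)) \/
        n = 2%N /\
        map_poly tau F =
          lam ^+ s *: (monic_reciprocal s G \Po (lam^-1 *: 'X))].

Lemma codes_equiv_only_if : codes_Gamma_equiv sigma E n s k F G -> poly_equivalent.
Proof.
move=> [phi [psi [[phi_bij _] [psi_bij _] [U [V [rho [U_unit V_unit rho_aut codes]]]]]]].
have U_unit' : (U : 'M[E]_n) \is a GRing.unit := U_unit.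
have V_unit' : (V : 'M[E]_n) \is a GRing.unit := V_unit.
(* Since U A V = (U A U^-1)(U V), absorbing [rho] and conjugation by U into [f] turns the
   equivalence into right multiplication by U V. *)
pose f : {rmorphism RF sigma F -> 'M[E]_n} := (conjugation U_unit' \o map_mx rho) \o phi.
pose iota1 : {rmorphism L -> 'M[E]_n} := f \o RFscalar sigma F.
pose iota2 : {rmorphism L -> 'M[E]_n} := psi \o RFscalar sigma G.
pose x1 := f (RFx sigma F); pose x2 := psi (RFx sigma G).
have f_inj : injective f.
  by move=> u v /conjugation_inj/map_mx_inj/(bij_inj phi_bij) ->.
have g1 : graded sigma iota1 1 x1 by apply: rmorph_graded (RFx_graded sigma F).
have g2 : graded sigma iota2 1 x2 by apply: rmorph_graded (RFx_graded sigma G).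
have fr1 : free_powers iota1 x1 (s * \dim {:L})%N.
  by apply: rmorph_free (RF_free F_monic F_deg).
have fr2 : free_powers iota2 x2 (s * \dim {:L})%N.
  by apply: rmorph_free (bij_inj psi_bij) (RF_free G_monic G_deg).
have sp2 y : exists a, y = expansion iota2 x2 (s * \dim {:L})%N a.
  have [psi' _ psiK] := psi_bij; have [a ya] := RF_spanned G_monic G_deg (psi' y).
  by exists a; rewrite -[y]psiK ya; apply: rmorph_expansion.
have rel1 : poly_relation iota1 x1 F by apply: rmorph_relation (RF_relation sigma F).
have rel2 : poly_relation iota2 x2 G by apply: rmorph_relation (RF_relation sigma G).
have UV_unit : U * V \is a GRing.unit by rewrite unitrMl.
have codeE y : power_span iota1 x1 (s * k)%N y <-> power_span iota2 x2 (s * k)%N (y * (U * V)).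
  rewrite -(@skew_code_power_span _ _ _ _ _ f) // -(@skew_code_power_span _ _ _ _ _ psi) //.
  split=> [[u Cu <-]|].
    have : [set psi x | x in skew_code sigma s k G]%classic (f u * (U * V)).
      rewrite codes; exists (phi u); first by exists u.
      rewrite /f /= /conjugation !mulrA mulrVK //.
    by move=> [v Cv vz]; exists v.
  move=> [v Cv yv]; have : [set psi x | x in skew_code sigma s k G]%classic (psi v) by exists v.
  rewrite codes => -[_ [u Cu <-]] uv; exists u => //.
  apply: (mulIr UV_unit); rewrite -yv -uv /f /= /conjugation !mulrA mulrVK //.
have n_ge2' : (2 <= \dim {:L})%N by rewrite dim_L.
have ltkn' : (k < \dim {:L})%N by rewrite dim_L.
have [e [i12 gx1 cases]] := code_equivalence_generators sigma_gen pcharLp n_ge2' s_ge2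
  k_gt0 ltkn' g1 g2 fr1 fr2 sp2 UV_unit codeE.
have F0 := irreducible_coef0 F_irr F_deg; have G0 := irreducible_coef0 G_irr G_deg.
have s_gt0 : (0 < s)%N := ltnW s_ge2.
exists (frob pcharFqp e : {rmorphism Fq -> Fq}).
case: cases => [[b x1b]|[n2 [b x12]]].
  have [l nz_l lE] := scaled_relation sigma_gen s_gt0 F_monic F_deg F0 G_monic G_deg g2
    fr2 rel1 rel2 i12 x1b.
  exists l; split; [exact: prime_field_aut_frob|by []|left].
  apply/polyP => i; rewrite coef_map /= coefZ coef_comp_scaleX.
  have [le_is|lt_si] := leqP i s; last first.
    by rewrite !nth_default ?F_deg ?G_deg // rmorph0 mul0r mulr0.
  by rewrite mulrA -lE // exprVn mulfK // expf_neq0.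
have [l [nz_l ls lE]] := reciprocal_relation sigma_gen s_gt0 F_monic F_deg F0 G0 G_monic G_deg
  gx1 fr2 rel1 rel2 i12 n2 x12.
exists l; split; [exact: prime_field_aut_frob|by []|right; split; first by rewrite -dim_L].
apply/polyP => i; rewrite coef_map /= coefZ coef_comp_scaleX coefZ coef_poly.
have [le_is|lt_si] := leqP i s; last first.
  rewrite ltnS leqNgt lt_si /= nth_default ?F_deg // rmorph0 mulr0 mul0r mulr0 //.
rewrite ltnS le_is horner_coef0 ls exprVn !mulrA mulfK // -lE //.
by rewrite mulfK // expf_neq0.
Qed.

Let j : {rmorphism Fq -> E} := in_alg E.
Let m : {rmorphism L -> 'M[E]_n} := cyc_mul dim_L j.
Let card_E : #|finvect_type E| = (#|Fq| ^ s)%N.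
Proof. by rewrite card_finvect dim_E. Qed.

Let matrix_presentation_ext : exists y : 'M[E]_n,
  [/\ y \is a GRing.unit, graded sigma m 1 y, poly_relation m y F &
      free_powers m y (s * n)%N].
Proof.
exact: (@matrix_presentation _ _ _ sigma_gen _ dim_L (finvect_type E) j s F card_E F_deg
  F_irr (irreducible_coef0 F_irr F_deg)).
Qed.

Let RF_iso_ext (P : {poly Fq}) (iota : {rmorphism L -> 'M[E]_n}) (x : 'M[E]_n) :
    P \is monic -> size P = s.+1 -> (forall a, iota a%:A = (a%:A)%:M) ->
    graded sigma iota 1 x -> poly_relation iota x P ->
    free_powers iota x (s * n)%N -> 
  exists phi : {rmorphism RF sigma P -> 'M[E]_n},
  [/\ Fq_alg_iso phi, forall c, phi (RFscalar sigma P c) = iota c &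
      phi (RFx sigma P) = x].
Proof.
move=> P_monic P_deg iota_lin gx rel fr.
have [phi [phi_bij phiC phiX]] := @RF_iso _ _ sigma _ dim_L (finvect_type E) s P card_E
  P_monic P_deg iota x gx rel fr.
by exists phi; split=> //; split=> // a; rewrite -iota_lin -phiC.
Qed.

(** One presentation (m, y) of R_F is moved by a Frobenius power on the matrix entries, so that its
    twist satisfies F^tau. Changing the generator by a factor b of suitable norm then presents R_G
    in the same matrix ring. *)
Lemma codes_equiv_if : poly_equivalent -> codes_Gamma_equiv sigma E n s k F G.
Proof.
move=> [tau [l [_ nz_l relFG]]].
have [e tauE] := finField_endo_frob pcharFqp tau.
have [y [y_unit gy rely fry]] := matrix_presentation_ext.
have m_lin a : m a%:A = (a%:A)%:M by apply: cyc_mul_scalar.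
have [phi [phi_iso phiC phiX]] := RF_iso_ext F_monic F_deg m_lin gy rely fry.
pose rho : {rmorphism E -> E} := frob pcharEp e.
pose iota1 : {rmorphism L -> 'M[E]_n} := map_mx rho \o m.
pose x := map_mx rho y.
have [e' frobK] : exists e', forall c : L, (c ^+ (p ^ e)) ^+ (p ^ e') = c.
  exact: (@frob_inverse (finvect_type L) p pcharLp e).
pose iota2 := twist pcharLp e' iota1.
have gx : graded sigma iota2 1 x.
  by apply: twist_graded; apply: (rmorph_graded (f := map_mx rho)) gy.
have frx : free_powers iota2 x (s * n)%N.
  by apply/twist_free/(rmorph_free (f := map_mx rho)) => //; apply: map_mx_inj.
have relx := @twist_relation _ _ _ pcharLp _ _ frobK _ iota1 x _ _ F_deg
  (rmorph_relation (f := map_mx rho) (iota' := iota1) (fun=> erefl) rely).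
have x_unit : x \is a GRing.unit by apply: (rmorph_unit (map_mx rho : {rmorphism 'M[E]_n -> _})).
(* The entrywise [rho] raises scalars to the power p^e and the twist on L undoes this, so the new
   presentation is again Fq-linear. *)
have iota2_lin a : iota2 a%:A = (a%:A)%:M.
  have aK : (a ^+ (p ^ e')) ^+ (p ^ e) = a.
    apply: (fmorph_inj (in_alg L)); rewrite /= -exprM mulnC exprM.
    by have := frobK a%:A; rewrite !exprZn !expr1n.
  rewrite /iota2 twistE exprZn expr1n /iota1 [LHS]/= [cyc_mul _ _ _]m_lin map_scalar_mx.
  by rewrite /rho /= /frob exprZn expr1n aK.
have [x2 [W [W_unit gx2 frx2 relx2 code2]]] : exists x2 W, 
    [/\ W \is a GRing.unit, graded sigma iota2 1 x2, free_powers iota2 x2 (s * n)%N,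
      poly_relation iota2 x2 G &
      forall u, power_span iota2 x2 (s * k)%N u <-> power_span iota2 x (s * k)%N (u * W)].
  case: relFG => [FG|[n2 FG]].
    have nz_lV : l^-1 != 0 by rewrite invr_eq0.
    have [b Nb] := norm_surj sigma_gen dim_L nz_lV.
    have nz_b : b != 0.
      apply: contraNneq nz_lV => b0; move: Nb.
      rewrite partial_normS b0 mul0r => /esym/eqP.
      by rewrite scaler_eq0 oner_eq0 orbF.
    exists (iota2 b * x), 1; split; rewrite ?unitr1 //.
    - exact: scaled_graded.
    - exact: scaled_free.
    - apply: (scaled_presentation (h := fun i => F`_i ^+ (p ^ e)) gx G_deg relx nz_l)
        => [|i le_i]; first by rewrite dim_L.
      rewrite -tauE -coef_map FG coefZ coef_comp_scaleX exprVn -mulrA divfK //.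
      by rewrite expf_neq0.
    - by move=> u; rewrite mulr1; apply: scaled_power_span.
  have [b Nb] := norm_surj sigma_gen dim_L nz_l.
  have nz_b : b != 0.
    apply: contraNneq nz_l => b0; move: Nb.
    rewrite partial_normS b0 mul0r => /esym/eqP.
    by rewrite scaler_eq0 oner_eq0 orbF.
  have n2' : \dim {:L} = 2%N by rewrite dim_L.
  have G0 := irreducible_coef0 G_irr G_deg.
  have sk_gt0 : (0 < s * k)%N by rewrite muln_gt0 k_gt0 ltnW.
  have sn_gt0 : (0 < s * n)%N by rewrite muln_gt0 ltnW.
  (* The generator b x^-1 lists the powers backwards, and the right factor x^(sk-1) restores the
     code of x. *)
  exists (iota2 b / x), (x ^+ (s * k).-1); split.
  - exact: unitrX.
  - exact: reciprocal_graded.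
  - exact: reciprocal_free.
  - have nz_c : l ^+ s / G`_0 != 0 by rewrite mulf_neq0 ?invr_eq0 ?expf_neq0.
    apply: (reciprocal_presentation (h := fun i => F`_i ^+ (p ^ e)) gx x_unit n2'
      G_deg relx nz_c) => [|i le_i].
      by rewrite dim_L; apply: Nb.
    rewrite -tauE -coef_map FG coefZ coef_comp_scaleX coefZ coef_poly ltnS le_i.
    rewrite horner_coef0 exprVn -!mulrA mulVf ?expf_neq0 // mulr1.
    by rewrite mulrA.
  - by move=> u; apply: reciprocal_power_span.
have [psi [psi_iso psiC psiX]] := RF_iso_ext G_monic G_deg iota2_lin gx2 relx2 frx2.
(* The code of the new generator times W is that of x = rho(y); hence U = 1 and V = W^-1. *)
exists phi, psi; split=> //; exists 1%:M, W^-1, rho; split.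
- exact: unitmx1.
- by rewrite -[_ \in _]/(W^-1 \is a GRing.unit) unitrV.
- exact: (@prime_field_aut_frob (finvect_type E)).
have spanE z : power_span iota2 x (s * k)%N z <-> 
    exists2 A, [set phi u | u in skew_code sigma s k F]%classic A & map_mx rho A = z.
  pose f : {rmorphism RF sigma F -> 'M[E]_n} := map_mx rho \o phi.
  have fC c : f (RFscalar sigma F c) = iota1 c by rewrite /f /= phiC.
  have fX : f (RFx sigma F) = x by rewrite /f /= phiX.
  rewrite -(twist_power_span pcharLp frobK) -(skew_code_power_span fC fX).
  split=> [[u Cu <-]|[_ [u Cu <-] <-]]; last by exists u.
  by exists (phi u) => //; exists u.
apply/seteqP; split=> z.
  move=> /(skew_code_power_span psiC psiX)/code2/spanE[A CA Az].
  by exists A => //; rewrite mul1mx Az -[_ *m _]/(_ * _) mulrK.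
move=> [A CA <-]; apply/(skew_code_power_span psiC psiX)/code2.
rewrite mul1mx -[_ *m _]/(map_mx rho A * W^-1) mulrVK //.
by apply/spanE; exists A.
Qed.

End Main.

Theorem theorem5p10 (p q n s k : nat)
    (Fq : finFieldType) (L : splittingFieldType Fq) (E : fieldExtType Fq)
    (sigma : gal_of {:L}) (F G : {poly Fq})
    (p_prime : prime p)
    (q_pow : exists2 e : nat, (0 < e)%N & q = (p ^ e)%N)
    (card_Fq : #|Fq| = q)
    (n_ge2 : (2 <= n)%N) (s_ge2 : (2 <= s)%N) (k_bounds : (1 <= k <= n - 1)%N)
    (dim_L : \dim {:L} = n) (dim_E : \dim {:E} = s)
    (sigma_gen : generator 'Gal({:L} / 1)%g sigma)
    (F_monic : F \is monic) (F_irr : irreducible_poly F)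
    (F_deg : size F = s.+1)
    (G_monic : G \is monic) (G_irr : irreducible_poly G)
    (G_deg : size G = s.+1) :
  codes_Gamma_equiv sigma E n s k F G <->
  exists (tau : {rmorphism Fq -> Fq}) (lam : Fq),
    [/\ prime_field_aut tau, lam != 0
      & map_poly tau F = lam ^+ s *: (G \Po (lam^-1 *: 'X)) \/
        n = 2%N /\
        map_poly tau F =
          lam ^+ s *: (monic_reciprocal s G \Po (lam^-1 *: 'X))].
Proof.
have [k_gt0 le_kn] := andP k_bounds.
case: n n_ge2 dim_L le_kn {k_bounds} => [//|n'] n_ge2 dim_L le_kn.
have ltkn : (k < n'.+1)%N by lia.
have [e _ qE] := q_pow.
have pcharFqp : p \in [pchar Fq] by apply: (@card_finPcharP _ _ e); rewrite ?card_Fq.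
by split; [exact: (codes_equiv_only_if pcharFqp) | exact: (codes_equiv_if pcharFqp)].
Qed.
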